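(* Let $\beta$ be a positive root, let $\beta=s_{i_r}\cdots s_{i_2}s_{i_1}\alpha_j$ be a positive expression for $\beta$, and let $\pm_1,\pm_2,\dots,\pm_r$ be a choice of signs such that $\Sigma^{\pm_r}_{i_r}\cdots\Sigma^{\pm_2}_{i_2}\Sigma^{\pm_1}_{i_1}S_j$ is defined. Then the brick $\Sigma^{\pm_r}_{i_r}\cdots\Sigma^{\pm_2}_{i_2}\Sigma^{\pm_1}_{i_1}S_j$ has stability domain $$\mathrm{Stab}\bigl(\Sigma^{\pm_r}_{i_r}\cdots\Sigma^{\pm_2}_{i_2}\Sigma^{\pm_1}_{i_1}S_j\bigr)=\sigma_{i_r}^{\pm_r}\cdots\sigma_{i_2}^{\pm_2}\sigma_{i_1}^{\pm_1}(\alpha_j^{\perp}).$$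
   Context: Root system. Let $d_1,\dots,d_n$ be positive integers and let $A=(A_{ij})$ be an $n\times n$ integer matrix with $A_{ii}=2$, $d_iA_{ij}=d_jA_{ji}$, and $A_{ij}\le 0$ for $i\ne j$ (a crystallographic symmetrizable Cartan matrix). Let $V$ be the real vector space with basis $\alpha_1,\dots,\alpha_n$, with symmetric bilinear form $(\alpha_i,\alpha_j)=d_iA_{ij}$; put $\alpha_i^\vee=d_i^{-1}\alpha_i$ and $s_i(x)=x-(\alpha_i^\vee,x)\alpha_i$. Let $W\subset \mathrm{GL}(V)$ be generated by the $s_i$. The set of (real) roots is $\Phi=\{w\alpha_i: w\in W,\ 1\le i\le n\}$; every root is a nonnegative (positive root, $\Phi^+$) or nonpositive (negative root) combination of the $\alpha_i$. Let $V^*$ be the dual space with pairing $\langle\ ,\ \rangle$, with $W$ acting by $\langle w\eta,w\beta\rangle=\langle\eta,\beta\rangle$, and for $\beta\in V$ put $\beta^\perp=\{\theta\in V^*:\langle\theta,\beta\rangle=0\}$. Positive expressions. A positive expression for a positive root $\beta$ is a formula $\beta=s_{i_r}\cdots s_{i_1}\alpha_j$ ($r\ge 0$) such that for all $1\le k\le r$, $s_{i_k}s_{i_{k-1}}\cdots s_{i_1}\alpha_j-s_{i_{k-1}}\cdots s_{i_1}\alpha_j\in\mathbb R_{>0}\alpha_{i_k}$. Cone operations. For a convex polyhedral cone $K\subseteq V^*$: $\sigma_i^+(K)=s_i(K\cap\{x:\langle x,\alpha_i\rangle\ge0\})$ and $\sigma_i^-(K)=s_i(K\cap\{x:\langle x,\alpha_i\rangle\le0\})$.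 Preprojective algebra. Put $d_{ij}=\mathrm{LCM}(d_i,d_j)$, $L=\mathrm{LCM}(d_1,\dots,d_n)$. Let $\kappa(L)/\kappa$ be a Galois extension of fields with cyclic Galois group of order $L$, and for $d\mid L$ let $\kappa(d)$ be the unique subextension of degree $d$ over $\kappa$. Let $\Gamma$ be the quiver with vertices $1,\dots,n$ and, for $i\neq j$, $-d_iA_{ij}/d_{ij}$ arrows $i\to j$; fix a bijection $a\mapsto a^*$ between arrows $i\to j$ and arrows $j\to i$ with $(a^* )^*=a$. Let $E(j\leftarrow i)$ be the $\kappa(d_{ij})$-vector space with basis the arrows $i\to j$, regarded as a $\kappa(d_j)$-$\kappa(d_i)$-bimodule. The path algebra is the tensor algebra over $\prod_i\kappa(d_i)$ of the bimodule $\bigoplus_{i\ne j}E(j\leftarrow i)$. For $i\ne j$ let $(b^{ji}_k)_k$ be a $\kappa(d_j)$-basis of $\kappa(d_{ij})$ and $((b^{ji}_k)^* )_k$ the dual basis for the trace pairing $(b,b')\mapsto\mathrm{tr}_{\kappa(d_{ij})/\kappa(d_j)}(bb')$. Fix signs $\mathrm{sgn}(i,j)\in\{\pm1\}$ for $i\ne j$ with $\mathrm{sgn}(i,j)=-\mathrm{sgn}(j,i)$. The preprojective algebra $\Lambda$ is the quotient of the path algebra by the relations $\sum_{j\ne i}\mathrm{sgn}(i,j)\sum_{a:i\to j}\sum_k (b^{ji}_k)^*a^*\otimes a\,b^{ji}_k=0$ for $1\le i\le n$ (up to isomorphism independent of the choices). A $\Lambda$-module $M$ (left module) is a collection of $\kappa(d_i)$-vector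 spaces $M_i$ with $\kappa(d_j)$-linear maps $M_{j\leftarrow i}:E(j\leftarrow i)\otimes_{\kappa(d_i)}M_i\to M_j$ satisfying these relations; $M$ is finite dimensional if all $M_i$ are finite dimensional over $\kappa$, and then $\dim M=\sum_i(\dim_{\kappa(d_i)}M_i)\alpha_i\in V$. $S_i$ is the module with $\kappa(d_i)$ at vertex $i$ and $0$ elsewhere. A brick is a nonzero finite dimensional $\Lambda$-module whose endomorphism ring is a division ring. Stability. $M$ is $\theta$-semistable, for $\theta\in V^*$, if $\langle\theta,\dim M\rangle=0$ and $\langle\theta,\dim K\rangle\ge0$ for every submodule $K\subseteq M$. The stability domain $\mathrm{Stab}(M)$ is the set of $\theta\in V^*$ for which $M$ is $\theta$-semistable. Reflection functors. $\mathrm{NoSub}_i$ (resp. $\mathrm{NoQuot}_i$) is the full subcategory of finite dimensional $\Lambda$-modules not having $S_i$ as a submodule (resp. quotient). Put $M_{\partial i}=\bigoplus_{j\ne i}E(i\leftarrow j)\otimes_{\kappa(d_j)}M_j$; let $M_{i,\mathrm{in}}:M_{\partial i}\to M_i$ be $\mathrm{sgn}(i,j)M_{i\leftarrow j}$ on the $j$th summand, and $M_{i,\mathrm{out}}:M_i\to M_{\partial i}$ have $j$th component $m\mapsto\sum_{a:i\to j}\sum_k(b^{ji}_k)^*a^*\otimes M_{j\leftarrow i}(a\,b^{ji}_k\otimes m)$. The preprojective relations say $M_{i,\mathrm{in}}M_{i,\mathrm{out}}=0$; $M\in\mathrm{NoSub}_i$ iff $M_{i,\mathrm{out}}$ is injective,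 $M\in\mathrm{NoQuot}_i$ iff $M_{i,\mathrm{in}}$ is surjective. For $M\in\mathrm{NoQuot}_i$, $\Sigma_i(M)=\Sigma_i^+(M)$ is obtained from $M$ by replacing $M_i$ by $\mathrm{Ker}(M_{i,\mathrm{in}})$, with out-map the inclusion $\mathrm{Ker}(M_{i,\mathrm{in}})\hookrightarrow M_{\partial i}$ and in-map $M_{i,\mathrm{out}}M_{i,\mathrm{in}}:M_{\partial i}\to\mathrm{Ker}(M_{i,\mathrm{in}})$, all other data unchanged. For $M\in\mathrm{NoSub}_i$, $\Sigma_i^{-1}(M)=\Sigma_i^-(M)$ is obtained by replacing $M_i$ by $\mathrm{CoKer}(M_{i,\mathrm{out}})$, with in-map the quotient map from $M_{\partial i}$ and out-map $\mathrm{CoKer}(M_{i,\mathrm{out}})\to M_{\partial i}$ induced by $M_{i,\mathrm{out}}M_{i,\mathrm{in}}$, all other data unchanged. These are mutually inverse equivalences between $\mathrm{NoQuot}_i$ and $\mathrm{NoSub}_i$; $\Sigma_i$ is only defined on $\mathrm{NoQuot}_i$ and $\Sigma_i^{-1}$ only on $\mathrm{NoSub}_i$. The expression $\Sigma^{\pm_r}_{i_r}\cdots\Sigma^{\pm_1}_{i_1}S_j$ is defined if for each $q$ the partial product $\Sigma^{\pm_{q-1}}_{i_{q-1}}\cdots\Sigma^{\pm_1}_{i_1}S_j$ lies in $\mathrm{NoQuot}_{i_q}$ when $\pm_q=+$, and in $\mathrm{NoSub}_{i_q}$ when $\pm_q=-$. *)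

(* Defs.v *)
From HB Require Import structures.
From mathcomp Require Import all_boot all_order all_algebra.
From mathcomp Require Import all_fingroup all_solvable all_field.
From mathcomp Require Import classical_sets reals.

Set Implicit Arguments.
Unset Strict Implicit.
Unset Printing Implicit Defensive.

Import Order.TTheory GRing.Theory Num.Theory.
Local Open Scope ring_scope.

Record symCartan (n : nat) := SymCartan {
  cd : 'I_n -> nat;
  cA : 'M[int]_n;
  cd_gt0 : forall i, (0 < cd i)%N;
  cA_diag : forall i, cA i i = 2;
  cA_sym : forall i j, (cd i)%:Z * cA i j = (cd j)%:Z * cA j i;
  cA_le0 : forall i j, i != j -> cA i j <= 0
}.

Section RootSystem.

Variables (R : realType) (n : nat) (C : symCartan n).

Definition rspace := 'rV[R]_n.
Definition rdual := 'Hom(rspace, R^o).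

Definition sroot (i : 'I_n) : rspace := delta_mx 0 i.

Definition form (x y : rspace) : R :=
  \sum_i \sum_j x 0 i * y 0 j * ((cd C i)%:R * (cA C i j)%:~R).

Definition scoroot (i : 'I_n) : rspace := (cd C i)%:R^-1 *: sroot i.

Definition refl (i : 'I_n) : 'End(rspace) :=
  linfun (fun x : rspace => x - form (scoroot i) x *: sroot i).

Inductive weyl : 'End(rspace) -> Prop :=
| weyl_refl i : weyl (refl i)
| weyl_id : weyl \1%VF
| weyl_comp u v : weyl u -> weyl v -> weyl (u \o v)%VF
| weyl_inv u : weyl u -> weyl (u^-1)%VF.

Definition root_of (b : rspace) : Prop :=
  exists w i, weyl w /\ b = w (sroot i).

Definition positive_root (b : rspace) : Prop :=
  root_of b /\ forall i, 0 <= b 0 i.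

(* The index sequence i_1, ..., i_r is given by a function on nat of which only
   the values at 1, ..., r matter; [root_word r] is s_{i_r} ... s_{i_1} alpha_j. *)
Fixpoint root_word (idx : nat -> 'I_n) (j : 'I_n) (r : nat) : rspace :=
  if r is q.+1 then refl (idx r) (root_word idx j q) else sroot j.

Definition positive_expression (b : rspace) (r : nat) (idx : nat -> 'I_n)
    (j : 'I_n) : Prop :=
  b = root_word idx j r /\
  forall k, (1 <= k <= r)%N ->
    exists2 c : R, 0 < c &
      root_word idx j k - root_word idx j k.-1 = c *: sroot (idx k).

(* The action such that <w t, w b> = <t, b> *)
Definition dual_act (w : 'End(rspace)) (t : rdual) : rdual := (t \o w^-1)%VF.

Local Open Scope classical_set_scope.

Definition perp (b : rspace) : set rdual := [set t | t b = 0].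

Definition sigma_pos (i : 'I_n) (K : set rdual) : set rdual :=
  dual_act (refl i) @` (K `&` [set t | 0 <= t (sroot i)]).

Definition sigma_neg (i : 'I_n) (K : set rdual) : set rdual :=
  dual_act (refl i) @` (K `&` [set t | t (sroot i) <= 0]).

(* A sign is a boolean: [true] is +, [false] is -. *)
Definition sigma_sgn (e : bool) := if e then sigma_pos else sigma_neg.

Fixpoint sigma_word (idx : nat -> 'I_n) (e : nat -> bool) (j : 'I_n) (r : nat) :
    set rdual :=
  if r is q.+1 then sigma_sgn (e r) (idx r) (sigma_word idx e j q)
  else perp (sroot j).

End RootSystem.

Definition cdd n (C : symCartan n) (i j : 'I_n) : nat := lcmn (cd C i) (cd C j).

Definition cL n (C : symCartan n) : nat := \big[lcmn/1%N]_i cd C i.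

(* Number of arrows i -> j. The division is exact: both d_i and d_j divide
   d_i A_ij = d_j A_ji. *)
Definition narr n (C : symCartan n) (i j : 'I_n) : nat :=
  if i == j then 0%N else ((cd C i * `|cA C i j|) %/ cdd C i j)%N.

(* [kap] and [kL] are kappa and kappa(L), and [ksub d] is kappa(d); by Galois
   theory it is determined by its degree when d divides L, and its values at
   other d are not used. The trace of kappa(d_ij) over kappa(d_j) is the sum of
   the conjugates, [galTrace]. [bas j i] and [dbas j i] are the families b^{ji} and (b^{ji})^*. *)
Record preprojData (n : nat) (C : symCartan n) := PreprojData {
  kap : fieldType;
  kL : splittingFieldType kap;
  kL_galois : galois 1%AS {:kL}%AS;
  kL_cyclic : cyclic 'Gal({:kL}%AS / 1%AS)%g;
  kL_card : #|'Gal({:kL}%AS / 1%AS)%g| = cL C;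
  ksub : nat -> {subfield kL};
  ksub_dim : forall m, (m %| cL C)%N -> \dim (ksub m) = m;
  star : forall i j, 'I_(narr C i j) -> 'I_(narr C j i);
  starK : forall i j (a : 'I_(narr C i j)), star (star a) = a;
  sgn : 'I_n -> 'I_n -> int;
  sgn_pm1 : forall i j, i != j -> sgn i j = 1 \/ sgn i j = -1;
  sgnN : forall i j, i != j -> sgn i j = - sgn j i;
  bas : forall j i, 'I_(cdd C i j %/ cd C j) -> kL;
  bas_basis : forall j i, i != j ->
    basis_of (vspaceOver (ksub (cd C j)) (ksub (cdd C i j)))
      [tuple (@bas j i k : fieldOver (ksub (cd C j))) | k < cdd C i j %/ cd C j];
  dbas : forall j i, 'I_(cdd C i j %/ cd C j) -> kL;
  dbas_mem : forall j i k, i != j -> @dbas j i k \in ksub (cdd C i j);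
  dbas_dual : forall j i k l, i != j ->
    galTrace (ksub (cd C j)) (ksub (cdd C i j)) (@bas j i k * @dbas j i l)
      = (k == l)%:R
}.

Arguments star {n C} D i j a : rename.
Arguments bas {n C} D j i k : rename.
Arguments dbas {n C} D j i k : rename.

Section Modules.

Variables (n : nat) (C : symCartan n) (D : preprojData C).

Definition kv (i : 'I_n) : fieldType := subvs_of (ksub D (cd C i)).

Definition kk (j i : 'I_n) : vectType (kv j) :=
  subvs_of (vspaceOver (ksub D (cd C j)) (ksub D (cdd C i j))).

Definition kk_val (j i : 'I_n) (x : kk j i) : kL D := vsval x.

(* The identity on kappa(d_ij), as an inverse of [kk_val]; all the elements of
   kappa(L) it is applied to below lie in kappa(d_ij). *)
Definition in_kk (j i : 'I_n) (x : kL D) : kk j i :=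
  vsproj (vspaceOver (ksub D (cd C j)) (ksub D (cdd C i j))) x.

Fact ksub_le (a b : nat) : (a %| b)%N -> (b %| cL C)%N ->
  (ksub D a <= ksub D b)%VS.
Proof.
move=> dab dbL; have daL := dvdn_trans dab dbL.
have gal (m : nat) : galois (ksub D m) {:kL D}.
  by apply: galoisS (kL_galois D); rewrite sub1v subvf.
have sub1 (m : nat) : ('Gal({:kL D} / ksub D m) \subset 'Gal({:kL D} / 1%AS))%g.
  by apply: galS; apply: sub1v.
have L0 : (0 < cL C)%N by rewrite -(kL_card D) cardG_gt0.
have card (m : nat) : (m %| cL C)%N -> #|'Gal({:kL D} / ksub D m)%g| = (cL C %/ m)%N.
  move=> dm; rewrite -(galois_dim (gal m)) (ksub_dim D dm); congr (_ %/ _)%N.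
  by rewrite -(kL_card D) -(galois_dim (kL_galois D)) dimv1 divn1.
have fx (m : nat) := elimT galois_fixedField (gal m).
rewrite -(fx a) -(fx b).
apply: fixedFieldS; rewrite -(cardSg_cyclic (kL_cyclic D)); try exact: sub1.
rewrite !card //.
case/dvdnP: dbL => x E; case/dvdnP: dab => y Ey.
have b0 : (0 < b)%N by move: L0; rewrite E muln_gt0 => /andP[].
have a0 : (0 < a)%N by move: b0; rewrite Ey muln_gt0 => /andP[].
by rewrite E mulnK // Ey mulnA mulnK // dvdn_mulr.
Qed.

Fact cdd_dvd (i j : 'I_n) : (cdd C i j %| cL C)%N.
Proof. by rewrite dvdn_lcm /cL (biglcmn_sup i) //= (biglcmn_sup j). Qed.

Fact mem_kk (j i : 'I_n) (x : kL D) :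
  (x \in vspaceOver (ksub D (cd C j)) (ksub D (cdd C i j)))
    = (x \in ksub D (cdd C i j)).
Proof. by rewrite mem_aspaceOver // ksub_le ?cdd_dvd ?dvdn_lcmr. Qed.

Fact kk_valP (j i : 'I_n) (x : kk j i) : kk_val x \in ksub D (cdd C i j).
Proof. by rewrite -mem_kk; apply: valP. Qed.

Fact in_kkK (j i : 'I_n) (x : kL D) :
  x \in ksub D (cdd C i j) -> kk_val (in_kk j i x) = x.
Proof. by rewrite -(mem_kk j) => xK; rewrite /kk_val /in_kk vsprojK. Qed.

(* The bimodule E(j <- i), free over kappa(d_ij) on the arrows i -> j. *)
Definition arr (j i : 'I_n) : vectType (kv j) := {ffun 'I_(narr C i j) -> kk j i}.

(* The element x a of E(j <- i), for an arrow a and x in kappa(d_ij) *)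
Definition arr_elt (j i : 'I_n) (a : 'I_(narr C i j)) (x : kL D) : arr j i :=
  [ffun a' => if a' == a then in_kk j i x else 0].

Definition arr_act (j i : 'I_n) (e : arr j i) (c : kv i) : arr j i :=
  [ffun a => in_kk j i (kk_val (e a) * vsval c)].

(* E(j <- i) (x)_{kappa(d_i)} U for a finite dimensional U, constructed from a
   basis of U as a direct sum of dim(U) copies of E(j <- i); its universal
   property is [tens_universal] below. *)
Definition tens (j i : 'I_n) (U : vectType (kv i)) : vectType (kv j) :=
  {ffun 'I_(\dim {:U}) -> arr j i}.

Definition pure (j i : 'I_n) (U : vectType (kv i)) (e : arr j i) (u : U) :
    tens j U :=
  [ffun l => arr_act e (coord (vbasis {:U}) l u)].

Definition tens_map (j i : 'I_n) (U U' : vectType (kv i)) (f : 'Hom(U, U'))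
    (t : tens j U) : tens j U' :=
  \sum_l pure (t l) (f (vbasis {:U})`_l).

Section Universal.

Variables (j i : 'I_n) (U : vectType (kv i)).

Fact kk_valD (x y : kk j i) : kk_val (x + y) = kk_val x + kk_val y.
Proof. by []. Qed.

Fact kk_valZ (c : kv j) (x : kk j i) : kk_val (c *: x) = vsval c * kk_val x.
Proof. by []. Qed.

Fact pureE (e : arr j i) (u : U) l a :
  kk_val (pure e u l a) = kk_val (e a) * vsval (coord (vbasis {:U}) l u).
Proof.
rewrite !ffunE in_kkK // memvM ?kk_valP //.
by rewrite (subvP (ksub_le _ _) _ (valP _)) ?cdd_dvd ?dvdn_lcml.
Qed.

Fact tens_eq (t t' : tens j U) :
  (forall l a, kk_val (t l a) = kk_val (t' l a)) -> t = t'.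
Proof.
by move=> tt'; apply/ffunP=> l; apply/ffunP=> a; apply: val_inj; apply: tt'.
Qed.

Fact tensDE (t t' : tens j U) l a :
  kk_val ((t + t') l a) = kk_val (t l a) + kk_val (t' l a).
Proof. by rewrite !ffunE. Qed.

Fact tensZE (c : kv j) (t : tens j U) l a :
  kk_val ((c *: t) l a) = vsval c * kk_val (t l a).
Proof. by rewrite !ffunE. Qed.

Fact pure_linearl (u : U) : linear (fun e : arr j i => pure e u).
Proof.
move=> c e e'; apply: tens_eq => l a; rewrite pureE tensDE tensZE !pureE.
by rewrite ffunE ffunE kk_valD kk_valZ mulrDl -mulrA.
Qed.

Fact pure_additiver (e : arr j i) (u v : U) :
  pure e (u + v) = pure e u + pure e v.
Proof.
apply: tens_eq => l a; rewrite pureE tensDE !pureE.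
by rewrite linearD /= mulrDr.
Qed.

Fact pure_balanced (e : arr j i) (c : kv i) (u : U) :
  pure (arr_act e c) u = pure e (c *: u).
Proof.
apply: tens_eq => l a; rewrite !pureE ffunE in_kkK.
  by rewrite linearZ /= mulrA.
by rewrite memvM ?kk_valP // (subvP (ksub_le _ _) _ (valP _)) ?cdd_dvd ?dvdn_lcml.
Qed.

Fact tens_decomp (t : tens j U) : t = \sum_l pure (t l) (vbasis {:U})`_l.
Proof.
apply/ffunP=> l; apply/ffunP=> a; rewrite sum_ffunE sum_ffunE.
have pl l' : pure (t l') (vbasis {:U})`_l' l a = if l' == l then t l a else 0.
  apply: (@val_inj _ _ (kk j i)); apply: (etrans (pureE _ _ _ _)).
  rewrite coord_free ?(basis_free (vbasisP _)) // eq_sym.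
  case: eqP => [->|_]; first by rewrite /= algid1; apply: mulr1.
  exact: mulr0.
by rewrite (eq_bigr _ (fun l' _ => pl l')) -big_mkcond big_pred1_eq.
Qed.

Lemma tens_universal (W : vectType (kv j)) (f : arr j i -> U -> W) :
  (forall u, linear (f^~ u)) ->
  (forall e u v, f e (u + v) = f e u + f e v) ->
  (forall e c u, f (arr_act e c) u = f e (c *: u)) ->
  exists! g : 'Hom(tens j U, W), forall e u, g (pure e u) = f e u.
Proof.
move=> fl fr fb.
pose g0 (t : tens j U) : W := \sum_l f (t l) (vbasis {:U})`_l.
have g0l : linear g0.
  move=> c t t'; rewrite /g0 scaler_sumr -big_split; apply: eq_bigr => l _ /=.
  by rewrite 2!ffunE fl.
pose g0L := GRing.isLinear.Build _ _ _ _ g0 g0l.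
pose g0M : {linear _ -> _} := HB.pack g0 g0L.
have fsum e (I : finType) (F : I -> U) : f e (\sum_x F x) = \sum_x f e (F x).
  have f0 : f e 0 = 0.
    by apply: (@addrI _ (f e 0)); rewrite addr0 -fr addr0.
  by elim/big_rec2: _ => // x y1 y2 _ <-; rewrite fr.
exists (linfun g0M); split=> [e u|g' g'E].
  rewrite lfunE /= /g0 [in RHS](coord_vbasis (memvf u)) fsum.
  by apply: eq_bigr => l _; rewrite ffunE fb.
apply/lfunP=> t; rewrite lfunE /= /g0 [in RHS](tens_decomp t) linear_sum.
by apply: eq_bigr => l _; apply: esym; apply: g'E.
Qed.

End Universal.

(* Finite dimensional representations: [act M j i] is M_{j <- i}. *)
Record rep := Rep {
  sp :> forall i : 'I_n, vectType (kv i);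
  act : forall j i : 'I_n, 'Hom(tens j (sp i), sp j)
}.

Definition preproj_relations (M : rep) : Prop :=
  forall (i : 'I_n) (m : M i),
    \sum_(j | j != i)
      (\sum_(a < narr C i j) \sum_(k < cdd C i j %/ cd C j)
         act M i j (pure (arr_elt (star D i j a) (dbas D j i k))
                         (act M j i (pure (arr_elt a (bas D j i k)) m))))
      *~ sgn D i j = 0.

Record fdmod := Fdmod {
  fdrep :> rep;
  fdrel : preproj_relations fdrep
}.

Definition is_morphism (M N : rep) (f : forall i, 'Hom(M i, N i)) : Prop :=
  forall j i (t : tens j (M i)),
    f j (act M j i t) = act N j i (tens_map (f i) t).

Definition is_submodule (M : rep) (K : forall i, {vspace M i}) : Prop :=
  forall j i (e : arr j i) (m : M i), m \in K i -> act M j i (pure e m) \in K j.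

Definition has_submodule_iso (M S : rep) : Prop :=
  exists2 f : forall i, 'Hom(S i, M i), is_morphism f & forall i, injective (f i).

Definition has_quotient_iso (M S : rep) : Prop :=
  exists2 f : forall i, 'Hom(M i, S i), is_morphism f &
    forall i (s : S i), exists m, f i m = s.

Definition brick (M : fdmod) : Prop :=
  (exists i (m : M i), m != 0) /\
  forall f : (forall i, 'End(M i)), is_morphism f ->
    ~ (forall i, f i = 0) ->
    exists2 g : (forall i, 'End(M i)), is_morphism g &
      forall i, (f i \o g i = \1)%VF /\ (g i \o f i = \1)%VF.

(* The simple module S_j: a line at vertex j, and 0 at the other vertices. *)
Definition simple_rep (j : 'I_n) : rep :=
  @Rep (fun i => 'rV[kv i]_(i == j)) (fun _ _ => 0).

Fact simple_relations (j : 'I_n) : preproj_relations (simple_rep j).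
Proof.
move=> i m; rewrite big1 // => j' _.
by rewrite big1 ?mul0rz // => a _; rewrite big1 // => k _; rewrite lfunE.
Qed.

Definition simple (j : 'I_n) : fdmod := @Fdmod (simple_rep j) (@simple_relations j).

Definition no_sub (i : 'I_n) (M : fdmod) : Prop :=
  ~ has_submodule_iso M (simple i).

Definition no_quot (i : 'I_n) (M : fdmod) : Prop :=
  ~ has_quotient_iso M (simple i).

(* M_{di}, the direct sum over j <> i of the E(i <- j) (x) M_j. The summand
   j = i of the type below is zero, as there is no arrow i -> i. *)
Definition bd (M : rep) (i : 'I_n) : Type := forall j, tens i (M j).

Definition bd_eq (M : rep) (i : 'I_n) (x y : bd M i) : Prop := forall j, x j = y j.

Definition bd_map (M N : rep) (i : 'I_n) (f : forall j, 'Hom(M j, N j))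
    (x : bd M i) : bd N i :=
  fun j => tens_map (f j) (x j).

Definition m_in (M : rep) (i : 'I_n) (x : bd M i) : M i :=
  \sum_(j | j != i) act M i j (x j) *~ sgn D i j.

Definition m_out (M : rep) (i : 'I_n) (m : M i) : bd M i :=
  fun j => \sum_(a < narr C i j) \sum_(k < cdd C i j %/ cd C j)
    pure (arr_elt (star D i j a) (dbas D j i k)) (act M j i (pure (arr_elt a (bas D j i k)) m)).

(* The functors are given by relations, as their values are only meant up to
   isomorphism. [same_off i phi] says that N agrees with M away from the vertex
   i, via isomorphisms phi_j : N_j -> M_j for j <> i. (phi_i plays no role,
   since E(i <- i) = 0.) *)
Definition same_off (i : 'I_n) (N M : rep) (phi : forall j, 'Hom(N j, M j)) : Prop :=
  (forall j, j != i -> bijective (phi j)) /\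
  (forall k j (t : tens k (N j)), k != i -> j != i ->
     phi k (act N k j t) = act M k j (tens_map (phi j) t)).

(* N is Sigma_i^+(M): iota identifies N_i with Ker(M_in), a subspace of M_{di}. *)
Definition is_Sigma_pos (i : 'I_n) (M N : fdmod) : Prop :=
  no_quot i M /\
  exists (phi : forall j, 'Hom(N j, M j)) (iota : forall j, 'Hom(N i, tens i (M j))),
  let incl (y : N i) : bd M i := fun j => iota j y in
  [/\ same_off i phi,
      forall y y' : N i, bd_eq (incl y) (incl y') -> y = y',
      forall x : bd M i, m_in x = 0 <-> exists y, bd_eq (incl y) x,
      forall y : N i, bd_eq (bd_map phi (m_out y)) (incl y) &
      forall z : bd N i, bd_eq (incl (m_in z)) (m_out (m_in (bd_map phi z))) ].

(* N is Sigma_i^-(M): proj identifies N_i with CoKer(M_out), a quotient of M_{di}. *)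
Definition is_Sigma_neg (i : 'I_n) (M N : fdmod) : Prop :=
  no_sub i M /\
  exists (phi : forall j, 'Hom(N j, M j)) (proj_ : forall j, 'Hom(tens i (M j), N i)),
  let proj (x : bd M i) : N i := \sum_(j | j != i) proj_ j (x j) in
  [/\ same_off i phi,
      forall y : N i, exists x, proj x = y,
      forall x : bd M i, proj x = 0 <-> exists m : M i, bd_eq (m_out m) x,
      forall z : bd N i, m_in z = proj (bd_map phi z) &
      forall x : bd M i, bd_eq (bd_map phi (m_out (proj x))) (m_out (m_in x)) ].

Definition is_Sigma (e : bool) := if e then is_Sigma_pos else is_Sigma_neg.

(* [Sigma_word idx e j r X]: the expression
   Sigma_{i_r}^{e_r} ... Sigma_{i_1}^{e_1} S_j is defined, and X is its value. *)
Fixpoint Sigma_word (idx : nat -> 'I_n) (e : nat -> bool) (j : 'I_n) (r : nat)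
    (X : fdmod) : Prop :=
  if r is q.+1 then
    exists2 Y, Sigma_word idx e j q Y & is_Sigma (e r) (idx r) Y X
  else X = simple j.

Section Stability.

Variable R : realType.

Definition dimvec (M : rep) (K : forall i, {vspace M i}) : rspace R n :=
  \sum_i (\dim (K i))%:R *: sroot R i.

Definition semistable (t : rdual R n) (M : fdmod) : Prop :=
  t (dimvec (fun i => {:M i}%VS)) = 0 /\
  forall K : (forall i, {vspace M i}), is_submodule K -> 0 <= t (dimvec K).

Definition Stab (M : fdmod) : set (rdual R n) :=
  [set t | semistable t M]%classic.

End Stability.
End Modules.
Arguments Stab {n C D} R M _.

(* Main.v *)
From HB Require Import structures.
From mathcomp Require Import all_boot all_order all_algebra.
From mathcomp Require Import all_fingroup all_solvable all_field.
From mathcomp Require Import ring boolp classical_sets reals.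
Require Import Defs.

(** The value of [Sigma_i^+] at [M] and the value of [Sigma_i^-] at [N] are two
    readings of one situation. Write [B] for the direct sum of the modules
    [E(i <- j) (x) P_j] over [j <> i], and let [P] and [Q] agree away from the
    vertex [i], so that they share [B]. They form a reflection pair when

      0 -> Q_i -> B -> P_i -> 0

    is exact (the out-map of [Q], then the in-map of [P]) and the two composites
    out o in agree on [B]. If [N] is [Sigma_i^+ M] then [(M, N)] is a reflection
    pair, and if [N] is [Sigma_i^- M] then [(N, M)] is one ([Sigma_pos_pair],
    [Sigma_neg_pair]). Since [dim B] is the sum of the [-A_ij dim P_j], exactness
    says that [s_i] exchanges the dimension vectors of [P] and [Q]
    ([refl_dimvec_full]).

    Stability. A submodule [K] of [Q] gives the submodule of [P] with the same
    components off [i] and with the image of [K_di] at [i] ([pull]); a submodule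
    [J] of [P] gives the submodule of [Q] with the preimage of [J_di] at [i]
    ([push]). Counting dimensions in the exact sequence, [s_i (dim K)] exceeds
    [dim (pull K)] and [dim (push J)] exceeds [s_i (dim J)] by a nonnegative
    multiple of [alpha_i]. Hence [theta] in [Stab P] with [theta(alpha_i) >= 0]
    is sent by [s_i] into [Stab Q], and [eta] in [Stab Q] with
    [eta(alpha_i) <= 0] into [Stab P] ([semistable_fwd], [semistable_bwd]).

    Positivity of the expression supplies the sign condition. When
    [dim P_i < dim Q_i], the in-map of [Q] has rank at most [dim P_i], so it is
    not onto; then [Q] has a submodule of codimension one at [i], and every
    [eta] in [Stab Q] satisfies [eta(alpha_i) <= 0] ([quotient_bound]). The
    opposite inequality makes the out-map of [P] non-injective and gives
    [theta(alpha_i) >= 0] on [Stab P] ([submodule_bound]). Each step of a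
    positive expression increases the dimension at [i], so [s_i] carries the
    stability domain of the new module into the half-space that [sigma_i] imposes
    on the old one, and the theorem follows by induction.

    Bricks are preserved because an endomorphism of either member of a pair is
    determined by its components off [i], and each such family extends to the
    other member ([brick_transfer]).

    All of this treats submodules and morphisms through the in- and out-maps at
    a vertex ([submoduleP], [morphismP]). That the out-map carries all the
    information of the action of the arrows leaving [i] is the adjunction between
    [E(j <- i) (x) -] and [E(i <- j) (x) -], made concrete by the trace form
    ([coef_inj], [coef_out]). *)

Set Implicit Arguments.
Unset Strict Implicit.
Unset Printing Implicit Defensive.

Import Order.TTheory GRing.Theory Num.Theory.
Local Open Scope ring_scope.

(** * Linear algebra *)

Section LinearMaps.

Variables (F : fieldType) (U V : vectType F).

Definition hom_of (f : U -> V) (fL : linear f) : 'Hom(U, V) :=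
  linfun (HB.pack f (GRing.isLinear.Build F U V _ f fL) : {linear U -> V}).

Lemma hom_ofE (f : U -> V) (fL : linear f) u : hom_of fL u = f u.
Proof. by rewrite lfunE. Qed.

Lemma limg_surj (f : 'Hom(U, V)) : limg f = fullv -> forall v, exists u, f u = v.
Proof.
move=> fV v; have: v \in limg f by rewrite fV memvf.
by case/memv_imgP => u _ ->; exists u.
Qed.

Lemma bij_inv (f : 'Hom(U, V)) :
  bijective f -> cancel f f^-1%VF /\ cancel f^-1%VF f.
Proof.
move=> [g fK gK]; split; first by apply/lker0_lfunK/lker0P/can_inj/fK.
by move=> y; apply: limg_lfunVK; rewrite -(gK y) memv_img ?memvf.
Qed.

Lemma limg_notin (f : 'Hom(U, V)) : limg f != fullv -> exists v, v \notin limg f.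
Proof.
move=> fV; have: ~~ (fullv <= limg f)%VS.
  by apply: contra fV => fV; rewrite eqEsubv subvf.
by case/subvPn => v _ vf; exists v.
Qed.

Lemma dim_limg_preim (f : 'Hom(U, V)) (W : {vspace V}) :
  injective f -> \dim (f @^-1: W)%VS = \dim (W :&: limg f)%VS.
Proof.
move=> fI; rewrite -[LHS](@limg_dim_eq _ _ _ f); last first.
  by move/lker0P/eqP: fI => ->; rewrite capv0.
by rewrite -lpreim_cap_limg lpreimK // capvSr.
Qed.

End LinearMaps.

Section Functional.

Variables (F : fieldType) (V : vectType F).

Lemma exists_functional (W : {vspace V}) v : v \notin W ->
  exists f : 'Hom(V, F^o), f v = 1 /\ forall w, w \in W -> f w = 0.
Proof.
move=> vW; pose x := v - projv W v.
have x0 : x != 0.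
  by apply: contra vW; rewrite subr_eq0 => /eqP ->; apply: memv_proj.
have fL : linear (fun u => coord [tuple x] ord0 u : F^o).
  by move=> c u u'; rewrite linearP.
pose f := hom_of fL.
have fx : f x = 1.
  have xF : free [tuple x] by rewrite seq1_free.
  by rewrite hom_ofE; apply: (coord_free ord0 ord0 xF).
exists (f \o (\1 - projv W))%VF; split=> [|w wW].
  by rewrite comp_lfunE add_lfunE opp_lfunE id_lfunE.
by rewrite comp_lfunE add_lfunE opp_lfunE id_lfunE projv_id ?subrr ?linear0.
Qed.

(** The kernel of a functional that vanishes on [W]. *)
Lemma exists_hyperplane (W : {vspace V}) : W != fullv ->
  exists2 H : {vspace V}, (W <= H)%VS & (\dim H).+1 = \dim {:V}.
Proof.
move=> Wf; have: ~~ (fullv <= W)%VS by apply: contra Wf; rewrite eqEsubv subvf.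
case/subvPn => v _ /exists_functional[f [fv fW]].
exists (lker f); first by apply/subvP=> w /fW; rewrite memv_ker => ->.
have := limg_ker_dim f fullv; rewrite capfv => <-; rewrite -addn1; congr addn.
apply/esym/eqP; rewrite eqn_leq; apply/andP; split.
  by rewrite (leq_trans (dimvS (subvf _))) // dimvf.
rewrite lt0n dimv_eq0; apply/eqP => f0.
have: f v \in limg f by rewrite memv_img ?memvf.
by rewrite f0 memv0 fv oner_eq0.
Qed.

End Functional.

(** * Direct sums indexed by the vertices *)

Section DirectSum.

Import VectorInternalTheory.

Variables (F : fieldType) (n : nat).
Implicit Types U : 'I_n -> vectType F.

(** Row vectors give the dependent product over the vertices a structure of finite
    dimensional vector space. *)
Definition dsum U : vectType F := 'rV[F]_(\sum_k dim (U k)).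

Definition dsum_mk U (x : forall k, U k) : dsum U := \mxrow_k v2r (x k).

Definition dsum_at U (k : 'I_n) (b : dsum U) : U k :=
  r2v (submxrow (b : 'rV__) k).

Lemma dsum_mkK U (x : forall k, U k) k : dsum_at k (dsum_mk x) = x k.
Proof. by rewrite /dsum_at mxrowK v2rK. Qed.

Lemma dsum_eq U (b b' : dsum U) : (forall k, dsum_at k b = dsum_at k b') -> b = b'.
Proof. by move=> bb'; apply/mxrowP => k; apply: r2v_inj; apply: bb'. Qed.

Lemma dsum_atK U (b : dsum U) : dsum_mk (fun k => dsum_at k b) = b.
Proof. by apply: dsum_eq => k; rewrite dsum_mkK. Qed.

Fact dsum_at_linear U k : linear (@dsum_at U k).
Proof.
move=> c x y; rewrite /dsum_at -linearP; congr r2v.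
by apply/rowP => i; rewrite !mxE.
Qed.

HB.instance Definition _ U k :=
  GRing.isLinear.Build F (dsum U) (U k) _ (@dsum_at U k) (@dsum_at_linear U k).

Lemma dim_dsum U : \dim {:dsum U} = (\sum_k \dim {:U k})%N.
Proof.
rewrite dimvf dim_matrix mul1r.
by apply: eq_bigr => k _; rewrite dimvf.
Qed.

Section Map.

Variables (U V : 'I_n -> vectType F) (f : forall k, 'Hom(U k, V k)).

Fact dsum_map_linear :
  linear (fun b : dsum U => dsum_mk (fun k => f k (dsum_at k b))).
Proof.
move=> c x y; apply: dsum_eq => k; rewrite dsum_mkK.
by rewrite [RHS]linearP /= !dsum_mkK 2!linearP.
Qed.

Definition dsum_map : 'Hom(dsum U, dsum V) := hom_of dsum_map_linear.

Lemma dsum_mapE b k : dsum_at k (dsum_map b) = f k (dsum_at k b).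
Proof. by rewrite hom_ofE dsum_mkK. Qed.

End Map.
End DirectSum.

(** * Tensor products with the arrow bimodules *)

Section Tensor.

Variables (n : nat) (C : symCartan n) (D : preprojData C).

Section Pure.

Variables (j i : 'I_n) (U : vectType (kv D i)).
Implicit Types (e : arr D j i) (u : U).

Lemma pureDl e e' u : pure (e + e') u = pure e u + pure e' u.
Proof. by have := pure_linearl u 1 e e'; rewrite !scale1r. Qed.

Lemma pure0l u : pure (0 : arr D j i) u = 0.
Proof. by apply: (@addrI _ (pure 0 u)); rewrite -pureDl !addr0. Qed.

Lemma pureZl c e u : pure (c *: e) u = c *: pure e u.
Proof. by have := pure_linearl u c e 0; rewrite !addr0 pure0l addr0. Qed.

Lemma pure_suml (I : finType) (E : I -> arr D j i) u :
  pure (\sum_x E x) u = \sum_x pure (E x) u.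
Proof.
apply: (big_morph (fun e => pure e u)); last exact: pure0l.
by move=> e e'; apply: pureDl.
Qed.

Lemma pure0r e : pure e (0 : U) = 0.
Proof. by apply: (@addrI _ (pure e 0)); rewrite -pure_additiver !addr0. Qed.

Lemma pure_sumr (I : finType) e (w : I -> U) :
  pure e (\sum_x w x) = \sum_x pure e (w x).
Proof.
apply: (big_morph (pure e)); last exact: pure0r.
by move=> u v; apply: pure_additiver.
Qed.

(** There is no arrow from [i] to itself, so the summand of index [i] in [M_di] is
    zero and an element of [M_di] is determined by its other components. *)
Lemma tens_loop (x y : tens i U) : x = y.
Proof.
apply/ffunP=> l; apply/ffunP=> -[a a_lt]; exfalso; clear -a_lt.
by rewrite /narr eqxx ltn0 in a_lt.
Qed.

End Pure.

Section Map.

Variables (j i : 'I_n) (U V W : vectType (kv D i)).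
Implicit Types (f : 'Hom(U, V)) (g : 'Hom(V, W)).

Lemma tens_map_pure f (e : arr D j i) u : tens_map f (pure e u) = pure e (f u).
Proof.
rewrite /tens_map; under eq_bigr => l _ do rewrite ffunE pure_balanced.
rewrite -pure_sumr; congr pure; rewrite [in RHS](coord_vbasis (memvf u)).
by rewrite linear_sum; apply: eq_bigr => l _; rewrite linearZ.
Qed.

Fact tens_map_linear f : linear (@tens_map _ _ D j i U V f).
Proof.
move=> c t t'; rewrite /tens_map scaler_sumr -big_split; apply: eq_bigr => l _.
by rewrite 2!ffunE pureDl pureZl.
Qed.

HB.instance Definition _ f := GRing.isLinear.Build (kv D j) (tens j U) (tens j V) _
  (@tens_map _ _ D j i U V f) (tens_map_linear f).

End Map.

Lemma tens_map_comp (j i : 'I_n) (U V W : vectType (kv D i))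
    (f : 'Hom(U, V)) (g : 'Hom(V, W)) (t : tens j U) :
  tens_map g (tens_map f t) = tens_map (g \o f)%VF t.
Proof.
rewrite (tens_decomp t) [tens_map f _]linear_sum [LHS]linear_sum [RHS]linear_sum /=.
by apply: eq_bigr => l _; rewrite !tens_map_pure comp_lfunE.
Qed.

Lemma tens_map_id (j i : 'I_n) (U : vectType (kv D i)) (f : 'End(U)) (t : tens j U) :
  f =1 id -> tens_map f t = t.
Proof.
move=> f1; rewrite [RHS]tens_decomp [in LHS](tens_decomp t) linear_sum.
by apply: eq_bigr => l _; rewrite /= tens_map_pure f1.
Qed.

Lemma tens_map_can (j i : 'I_n) (U V : vectType (kv D i)) (f : 'Hom(U, V))
    (g : 'Hom(V, U)) :
  cancel f g -> cancel (@tens_map _ _ D j i U V f) (tens_map g).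
Proof.
by move=> fK t; rewrite tens_map_comp tens_map_id // => u; rewrite comp_lfunE.
Qed.

Section Sub.

Variables (j i : 'I_n) (U : vectType (kv D i)).

Definition sub_incl (K : {vspace U}) : 'Hom(subvs_of K, U) := linfun vsval.

Lemma sub_inclE (K : {vspace U}) x : sub_incl K x = vsval x.
Proof. by rewrite lfunE. Qed.

Lemma sub_incl_can (K : {vspace U}) : cancel (sub_incl K) (linfun (vsproj K)).
Proof. by move=> x; rewrite !lfunE /= vsvalK. Qed.

(** Membership in [E(j <- i) (x) K], seen inside [E(j <- i) (x) U]. *)
Definition tsub (K : {vspace U}) (t : tens j U) : Prop :=
  exists s : tens j (subvs_of K), t = tens_map (sub_incl K) s.

Lemma pure_tsub (K : {vspace U}) e u : u \in K -> tsub K (pure e u).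
Proof.
move=> uK; exists (pure e (vsproj K u)).
by rewrite tens_map_pure sub_inclE vsprojK.
Qed.

Lemma sum_tsub (K : {vspace U}) (I : finType) (F : I -> tens j U) :
  (forall x, tsub K (F x)) -> tsub K (\sum_x F x).
Proof.
move=> /choice[s Fs]; exists (\sum_x s x).
by rewrite linear_sum; apply: eq_bigr.
Qed.

Lemma tsub_decomp (K : {vspace U}) t : tsub K t ->
  exists s : tens j (subvs_of K),
    t = \sum_l pure (s l) (vsval (vbasis {:subvs_of K})`_l).
Proof.
by case=> s ->; exists s; apply: eq_bigr => l _; rewrite sub_inclE.
Qed.

Lemma tsub_full (t : tens j U) : tsub fullv t.
Proof. by rewrite (tens_decomp t); apply: sum_tsub => l; apply/pure_tsub/memvf. Qed.

Lemma tsub0 (t : tens j U) : tsub 0 t -> t = 0.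
Proof.
case/tsub_decomp => s ->; rewrite big1 // => l _.
have := subvsP (vbasis {:subvs_of (0%VS : {vspace U})})`_l.
by rewrite memv0 => /eqP ->; rewrite pure0r.
Qed.

End Sub.

Lemma tsub_map (j i : 'I_n) (U V : vectType (kv D i)) (f : 'Hom(U, V))
    (K : {vspace U}) (K' : {vspace V}) (t : tens j U) :
  (forall u, u \in K -> f u \in K') -> tsub K t -> tsub K' (tens_map f t).
Proof.
move=> fK /tsub_decomp[s ->]; rewrite linear_sum; apply: sum_tsub => l /=.
by rewrite tens_map_pure; apply: pure_tsub; apply/fK/subvsP.
Qed.

Lemma dim_kk (j i : 'I_n) : \dim {:kk D j i} = (cdd C i j %/ cd C j)%N.
Proof.
have dj : (cd C j %| cdd C i j)%N := dvdn_lcmr _ _.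
have dL := cdd_dvd C i j.
rewrite dimvf -[LHS]/(\dim (vspaceOver _ _)) dim_aspaceOver ?ksub_dim //.
  exact: dvdn_trans dL.
exact: ksub_le.
Qed.

Lemma dim_tens (j i : 'I_n) (U : vectType (kv D i)) :
  \dim {:tens j U} = (\dim {:U} * narr C i j * (cdd C i j %/ cd C j))%N.
Proof.
rewrite -(dim_kk j i) !dimvf -mulnA -[dim (tens _ _)]/(#|_| * (#|_| * _))%N.
by rewrite !card_ord dimvf.
Qed.

(** Tensoring with [E(j <- i)] multiplies dimensions by [- A_ji]: both sides equal
    [d_i |A_ij| / d_j], by the symmetry of [d_i A_ij]. *)
Lemma narr_cartan (j i : 'I_n) : i != j ->
  (narr C i j * (cdd C i j %/ cd C j))%N = `|cA C j i|%N.
Proof.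
move=> ij; rewrite /narr (negPf ij).
have dj : (cd C j %| cdd C i j)%N := dvdn_lcmr _ _.
have E : (cd C i * `|cA C i j| = cd C j * `|cA C j i|)%N.
  by have /(congr1 absz) := cA_sym C i j; rewrite !abszM.
have dd : (cdd C i j %| cd C i * `|cA C i j|)%N.
  by rewrite dvdn_lcm dvdn_mulr //= E dvdn_mulr.
apply/eqP; rewrite -(eqn_pmul2r (cd_gt0 C j)) -mulnA divnK // divnK // E.
by rewrite mulnC.
Qed.

End Tensor.

(** * The trace form and the adjunction *)

Section Trace.

Variables (n : nat) (C : symCartan n) (D : preprojData C).

(** Subgroups of a cyclic group are normal, so every intermediate extension is
    Galois; this makes the trace take values in the smaller field. *)
Lemma galois_ksub (a b : nat) : (a %| b)%N -> (b %| cL C)%N ->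
  galois (ksub D a) (ksub D b).
Proof.
move=> ab bL.
have gb : galois (ksub D b) {:kL D}.
  by apply: galoisS (kL_galois D); rewrite sub1v subvf.
have Hn : ('Gal({:kL D} / ksub D b) <| 'Gal({:kL D} / 1%AS))%g.
  by rewrite -sub_abelian_normal ?cyclic_abelian ?kL_cyclic ?galS ?sub1v.
have := normal_fixedField_galois (kL_galois D) Hn.
rewrite (galois_fixedField gb); apply: galoisS.
by rewrite sub1v ksub_le.
Qed.

Variables (j i : 'I_n).
Local Notation K := (ksub D (cd C j)).
Local Notation E := (ksub D (cdd C i j)).

Let KE : (K <= E)%VS.
Proof. by apply: ksub_le; rewrite ?dvdn_lcmr ?cdd_dvd. Qed.

Definition trK (x : kL D) : kv D j := vsproj K (galTrace K E x).

Lemma trKE x : x \in E -> vsval (trK x) = galTrace K E x.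
Proof.
move=> xE; rewrite vsprojK //; apply: mem_galTrace => //.
by apply: galois_ksub; rewrite ?dvdn_lcmr ?cdd_dvd.
Qed.

Fact trK_zmod_morphism : zmod_morphism trK.
Proof. by move=> x y; rewrite /trK raddfB; apply: (linearB (vsproj K)). Qed.

HB.instance Definition _ :=
  GRing.isZmodMorphism.Build (kL D) (kv D j) trK trK_zmod_morphism.

Lemma trKZ (c : kv D j) x : x \in E -> trK (vsval c * x) = c * trK x.
Proof.
move=> xE; have cxE : vsval c * x \in E by rewrite memvM // (subvP KE _ (valP c)).
apply: val_inj; rewrite /= !trKE //.
rewrite /galTrace mulr_sumr; apply: eq_bigr => g gG.
rewrite rmorphM /=; congr (_ * _).
by apply: (fixed_gal KE gG); apply: valP.
Qed.

Hypothesis ij : i != j.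

Lemma bas_mem k : bas D j i k \in E.
Proof.
have := basis_mem (bas_basis D ij); rewrite -(mem_kk j); apply.
by apply/tnthP; exists k; rewrite tnth_mktuple.
Qed.

Lemma bas_span x : x \in E -> exists c : 'I_(cdd C i j %/ cd C j) -> kv D j,
  x = \sum_k vsval (c k) * bas D j i k.
Proof.
rewrite -(mem_kk j) => /(coord_basis (bas_basis D ij)) xE.
eexists => /=; rewrite {1}xE; apply: eq_bigr => k _.
by rewrite (nth_map k) ?size_enum_ord // nth_ord_enum.
Qed.

Lemma trK_dual k l : trK (bas D j i k * dbas D j i l) = (k == l)%:R.
Proof.
apply: val_inj; rewrite /= trKE ?memvM ?bas_mem ?dbas_mem // dbas_dual //.
by case: eqP => _ /=; rewrite ?algid1.
Qed.

Lemma bas_exp x : x \in E ->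
  x = \sum_k vsval (trK (x * dbas D j i k)) * bas D j i k.
Proof.
move=> xE; have [c cE] := bas_span xE.
rewrite [LHS]cE; apply: eq_bigr => k _; congr (vsval _ * _).
rewrite cE mulr_suml raddf_sum (bigD1 k) //= big1 ?addr0 => [|l lk].
  by rewrite -mulrA trKZ ?memvM ?bas_mem ?dbas_mem // trK_dual eqxx mulr1.
by rewrite -mulrA trKZ ?memvM ?bas_mem ?dbas_mem // trK_dual (negPf lk) mulr0.
Qed.

(** If [x] is not zero, multiplication by [x] is onto, and the trace is nonzero as
    it takes the value 1 on the product of two dual basis elements. *)
Lemma trK_nondegenerate x : x \in E ->
  (forall k, trK (x * bas D j i k) = 0) -> x = 0.
Proof.
move=> xE x0; apply/eqP; apply/negP => /negP xN.
have m_gt0 : (0 < cdd C i j %/ cd C j)%N.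
  rewrite divn_gt0 ?cd_gt0 // dvdn_leq ?dvdn_lcmr //.
  by rewrite lcmn_gt0 !cd_gt0.
pose k0 := Ordinal m_gt0.
(* The element z with x z = b_0 b_0^*, whose trace is 1. *)
have yE : x^-1 * (bas D j i k0 * dbas D j i k0) \in E.
  by rewrite !memvM ?memvV ?bas_mem ?dbas_mem.
have [c cE] := bas_span yE.
have := trK_dual k0 k0; rewrite eqxx -[bas _ _ _ _ * _](mulKf (invr_neq0 xN)) invrK.
rewrite cE mulr_sumr raddf_sum big1 => [/esym/eqP|k _]; first by rewrite oner_eq0.
by rewrite /= mulrCA trKZ ?x0 ?mulr0 // memvM ?bas_mem.
Qed.

End Trace.

Section Coef.

Variables (n : nat) (C : symCartan n) (D : preprojData C).

Section OneSpace.
Variables (i j : 'I_n) (U : vectType (kv D j)).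

(** The coordinates of [t] in the basis [a^* b_k^*] of [E(i <- j)] as a right module
    over [kappa(d_j)], read off with the trace form. *)
Definition coef (a : 'I_(narr C i j)) (k : 'I_(cdd C i j %/ cd C j))
    (t : tens i U) : U :=
  \sum_l trK j i (kk_val (t l (star D i j a)) * bas D j i k) *: (vbasis {:U})`_l.

Hypothesis ij : i != j.

Lemma kk_valPC (x : kk D i j) : kk_val x \in ksub D (cdd C i j).
Proof. by have := kk_valP x; rewrite /cdd lcmnC. Qed.

Lemma coef_pure e u a k :
  coef a k (pure e u) = trK j i (kk_val (e (star D i j a)) * bas D j i k) *: u.
Proof.
rewrite /coef [in RHS](coord_vbasis (memvf u)) scaler_sumr.
apply: eq_bigr => l _; rewrite pureE scalerA mulrAC mulrC trKZ ?[_ * trK _ _ _]mulrC //.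
by rewrite memvM ?kk_valPC ?bas_mem.
Qed.

Lemma coef_additive a k : zmod_morphism (coef a k).
Proof.
move=> t t'; rewrite /coef -sumrB; apply: eq_bigr => l _.
by rewrite -scalerBl -raddfB -mulrBl !ffunE.
Qed.

HB.instance Definition _ a k :=
  GRing.isZmodMorphism.Build (tens i U) U (coef a k) (coef_additive a k).

Lemma coef_inj t t' : (forall a k, coef a k t = coef a k t') -> t = t'.
Proof.
move=> tt'; apply: tens_eq => l a.
apply/eqP; rewrite -subr_eq0; apply/eqP.
apply: (trK_nondegenerate ij); first by rewrite memvB ?kk_valPC.
move=> k; have := tt' (star D j i a) k; rewrite /coef !starK => /eqP.
rewrite -subr_eq0 -sumrB; under eq_bigr => h _ do rewrite -scalerBl -raddfB -mulrBl.
move/eqP; have /freeP := basis_free (vbasisP {:U}).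
by move=> /[apply] /(_ l).
Qed.

End OneSpace.
End Coef.

Section Adjunction.

Variables (n : nat) (C : symCartan n) (D : preprojData C) (i j : 'I_n).
Hypothesis ij : i != j.

Lemma coef_map (U V : vectType (kv D j)) (f : 'Hom(U, V)) a k (t : tens i U) :
  coef a k (tens_map f t) = f (coef a k t).
Proof.
rewrite (tens_decomp t) [tens_map f _]linear_sum [LHS]raddf_sum [X in f X]raddf_sum.
rewrite linear_sum /=.
apply: eq_bigr => l _; rewrite tens_map_pure !coef_pure //.

by rewrite linearZ.
Qed.

Lemma coef_tsub (U : vectType (kv D j)) (K : {vspace U}) a k (t : tens i U) :
  tsub K t -> coef a k t \in K.
Proof.
move=> /tsub_decomp[s ->]; rewrite raddf_sum memv_suml // => l _ /=.
by rewrite coef_pure // memvZ // subvsP.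
Qed.

(** Left multiplication by [c] in [kappa(d_i)] acts on the coordinates by the matrix
    of multiplication by [c] in the basis [b]. The elements [arr_elt a b_k] are
    transformed by the same matrix, which is why the out-map is linear. *)
Lemma coefZ (U : vectType (kv D j)) (c : kv D i) a k (t : tens i U) :
  coef a k (c *: t) =
  \sum_l trK j i (vsval c * bas D j i k * dbas D j i l) *: coef a l t.
Proof.
have cE : vsval c \in ksub D (cdd C i j).
  by rewrite (subvP (ksub_le D _ _) _ (valP c)) ?cdd_dvd ?dvdn_lcml.
rewrite (tens_decomp t) scaler_sumr [LHS]raddf_sum /=.
under [in RHS]eq_bigr => l _ do rewrite [coef a l _]raddf_sum scaler_sumr.
rewrite [RHS]exchange_big /=.
apply: eq_bigr => h _ /=.
rewrite -pureZl coef_pure //; under eq_bigr => l _ do rewrite coef_pure // scalerA.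
rewrite -scaler_suml; congr (_ *: _).
rewrite ffunE kk_valZ mulrAC.
have xE : vsval c * bas D j i k \in ksub D (cdd C i j) by rewrite memvM ?bas_mem.
rewrite {1}(bas_exp ij xE) mulr_suml raddf_sum; apply: eq_bigr => l _ /=.
rewrite -(mulrA (vsval (trK _ _ _))) [bas _ _ _ l * _]mulrC trKZ //.
by rewrite memvM ?bas_mem ?kk_valPC.
Qed.

Lemma arr_eltE (a b : 'I_(narr C i j)) x : x \in ksub D (cdd C i j) ->
  kk_val (arr_elt (D := D) a x b) = if b == a then x else 0.
Proof. by move=> xE; rewrite ffunE; case: eqP => // _; rewrite in_kkK. Qed.

Lemma arr_span (e : arr D j i) : exists c : 'I_(narr C i j) -> _ -> kv D j,
  e = \sum_a \sum_k c a k *: arr_elt a (bas D j i k).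
Proof.
exists (fun a k => trK j i (kk_val (e a) * dbas D j i k)).
apply/ffunP => b; rewrite sum_ffunE (bigD1 b) //= [X in _ + X]big1; last first.
  move=> a ab; rewrite sum_ffunE big1 // => k _; rewrite ffunE.
  apply: val_inj; rewrite -[LHS]/(kk_val (_ *: arr_elt a (bas D j i k) b)).
  by rewrite kk_valZ arr_eltE ?bas_mem // eq_sym (negPf ab) mulr0.
rewrite addr0 sum_ffunE; apply: val_inj; rewrite -[LHS]/(kk_val (e b)).
rewrite {1}(bas_exp ij (kk_valP (e b))) raddf_sum /=; apply: eq_bigr => k _.
rewrite ffunE -[RHS]/(kk_val (_ *: arr_elt b (bas D j i k) b)).
by rewrite kk_valZ arr_eltE ?bas_mem ?eqxx.
Qed.

(** The coordinates of the out-map are the actions of the basis elements of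
    [E(j <- i)]: one half of the adjunction. *)
Lemma coef_out (M : rep D) (m : M i) a k :
  coef a k (m_out m j) = act M j i (pure (arr_elt a (bas D j i k)) m).
Proof.
rewrite /m_out raddf_sum (bigD1 a) //= [X in _ + X]big1 ?addr0; last first.
  move=> b ba; rewrite raddf_sum big1 // => l _ /=; rewrite coef_pure //.
  rewrite ffunE (inj_eq (can_inj (@starK _ _ _ _ _))) eq_sym (negPf ba).
  by rewrite mul0r raddf0 scale0r.
rewrite raddf_sum (bigD1 k) //= [X in _ + X]big1 ?addr0.
  rewrite coef_pure // ffunE eqxx in_kkK; last by rewrite /cdd lcmnC dbas_mem.
  by rewrite mulrC trK_dual // eqxx scale1r.
move=> l lk; rewrite coef_pure // ffunE eqxx in_kkK.
  by rewrite mulrC trK_dual // eq_sym (negPf lk) scale0r.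
by rewrite /cdd lcmnC dbas_mem.
Qed.

(** The out-map detects containment: with [tsub], this is how a condition on the
    out-map becomes a condition on the action of each arrow leaving [i]. *)
Lemma out_act (M : rep D) (K : {vspace M j}) (m : M i) :
  tsub K (m_out m j) -> forall e, act M j i (pure e m) \in K.
Proof.
move=> mK e; have [c ->] := arr_span e.
rewrite pure_suml linear_sum memv_suml // => a _.
rewrite pure_suml linear_sum memv_suml // => k _ /=.
by rewrite pureZl linearZ /= memvZ // -coef_out coef_tsub.
Qed.

Lemma out_act_eq (M N : rep D) (f : 'Hom(M j, N j)) (m : M i) (m' : N i) :
  tens_map f (m_out m j) = m_out m' j ->
  forall e, f (act M j i (pure e m)) = act N j i (pure e m').
Proof.
move=> mm' e; have [c ->] := arr_span e.
rewrite !pure_suml !linear_sum; apply: eq_bigr => a _ /=.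
rewrite !pure_suml !linear_sum; apply: eq_bigr => k _ /=.
rewrite !pureZl !linearZ /=.
by rewrite -(coef_out m) -coef_map mm' coef_out.
Qed.

End Adjunction.

(** * The neighbourhood of a vertex *)

Section Nbhd.

Variables (n : nat) (C : symCartan n) (D : preprojData C) (i : 'I_n).
Implicit Types U V W : forall j, vectType (kv D j).

(** [M_di] as a vector space; [V] may be the family underlying a module or a family
    of its subspaces. *)
Definition nbhd V : vectType (kv D i) := dsum (fun j => tens i (V j)).

Definition nbhd_map U V (f : forall j, 'Hom(U j, V j)) : 'Hom(nbhd U, nbhd V) :=
  dsum_map (fun j => hom_of (tens_map_linear (f j))).

Lemma nbhd_mapE U V (f : forall j, 'Hom(U j, V j)) (b : nbhd U) k :
  dsum_at k (nbhd_map f b) = tens_map (f k) (dsum_at k b).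
Proof. by rewrite dsum_mapE hom_ofE. Qed.

Lemma nbhd_eq V (b b' : nbhd V) :
  (forall j, j != i -> dsum_at j b = dsum_at j b') -> b = b'.
Proof.
move=> bb'; apply: dsum_eq => j; have [ji|] := eqVneq j i; last exact: bb'.
by move: b b' {bb'}; rewrite ji => b b'; apply: tens_loop.
Qed.

Lemma nbhd_map_ext U V (f g : forall j, 'Hom(U j, V j)) (b : nbhd U) :
  (forall j, j != i -> f j = g j) -> nbhd_map f b = nbhd_map g b.
Proof.
by move=> fg; apply: nbhd_eq => j ji; rewrite !nbhd_mapE fg.
Qed.

Lemma nbhd_map_can U V (f : forall j, 'Hom(U j, V j)) (g : forall j, 'Hom(V j, U j)) :
  (forall j, j != i -> cancel (f j) (g j)) -> cancel (nbhd_map f) (nbhd_map g).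
Proof.
by move=> fK b; apply: nbhd_eq => j ji; rewrite !nbhd_mapE tens_map_can //; apply: fK.
Qed.

Definition nbhd_single V (j : 'I_n) (t : tens i (V j)) : nbhd V :=
  dsum_mk (dfwith (fun=> 0) t).

Lemma nbhd_single_at V j (t : tens i (V j)) : dsum_at j (nbhd_single t) = t.
Proof. by rewrite dsum_mkK dfwith_in. Qed.

Lemma nbhd_single_out V j (t : tens i (V j)) k :
  k != j -> dsum_at k (nbhd_single t) = 0.
Proof. by move=> kj; rewrite dsum_mkK dfwith_out // eq_sym. Qed.

Definition nbhd_sub V (K : forall j, {vspace V j}) : {vspace nbhd V} :=
  limg (nbhd_map (fun j => sub_incl (K j))).

(** The components off [i] suffice, by [tens_loop]. *)
Lemma nbhd_subP V (K : forall j, {vspace V j}) b :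
  b \in nbhd_sub K <-> forall j, j != i -> tsub (K j) (dsum_at j b).
Proof.
split=> [/memv_imgP[s _ ->] j _|bK]; first by rewrite nbhd_mapE; eexists.
have bK' j : tsub (K j) (dsum_at j b).
  have [ji|/bK //] := eqVneq j i.
  by move: b {bK}; rewrite ji => b; exists 0; apply: tens_loop.
pose s j := sval (cid (bK' j)).
have -> : b = nbhd_map (fun j => sub_incl (K j)) (dsum_mk s).
  by apply: nbhd_eq => j _; rewrite nbhd_mapE dsum_mkK; apply: (svalP (cid (bK' j))).
by rewrite memv_img ?memvf.
Qed.

Lemma dim_nbhd V :
  \dim {:nbhd V} = (\sum_(j | j != i) `|cA C i j| * \dim {:V j})%N.
Proof.
rewrite dim_dsum [RHS]big_mkcond; apply: eq_bigr => j _.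
rewrite dim_tens -mulnA; case: eqVneq => [->|ji] /=.
  by rewrite /narr eqxx mul0n muln0.
rewrite narr_cartan //.
by rewrite mulnC.
Qed.

Lemma dim_nbhd_sub V (K : forall j, {vspace V j}) :
  \dim (nbhd_sub K) = (\sum_(j | j != i) `|cA C i j| * \dim (K j))%N.
Proof.
have fI : injective (nbhd_map (fun j => sub_incl (K j))).
  apply: can_inj; apply: (nbhd_map_can (g := fun j => linfun (vsproj (K j)))) => j _.
  exact: sub_incl_can.
rewrite limg_dim_eq; last by move/lker0P/eqP: fI => ->; rewrite capv0.
by rewrite dim_nbhd; apply: eq_bigr => j _; congr muln; rewrite dimvf.
Qed.

Lemma nbhd_sub_map U V (f : forall j, 'Hom(U j, V j)) (K : forall j, {vspace U j})
    (L : forall j, {vspace V j}) b :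
  (forall j, j != i -> forall u, u \in K j -> f j u \in L j) ->
  b \in nbhd_sub K -> nbhd_map f b \in nbhd_sub L.
Proof.
move=> fK /nbhd_subP bK; apply/nbhd_subP => j ji; rewrite nbhd_mapE.
by apply: tsub_map (fK j ji) (bK j ji).
Qed.

End Nbhd.

Section Vertex.

Variables (n : nat) (C : symCartan n) (D : preprojData C) (i : 'I_n).

Section InOut.

Variable M : rep D.

Fact in_map_linear :
  linear (fun b : nbhd i (sp M) => m_in (fun j => dsum_at j b) : M i).
Proof.
move=> c b b'; rewrite /m_in scaler_sumr -big_split; apply: eq_bigr => j _ /=.
by rewrite 2!linearP mulrzDl -scalerMzr.
Qed.

Definition in_map : 'Hom(nbhd i (sp M), M i) := hom_of in_map_linear.

Lemma in_mapE (x : bd M i) : in_map (dsum_mk x) = m_in x.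
Proof. by rewrite hom_ofE; apply: eq_bigr => j _; rewrite dsum_mkK. Qed.

(** Linearity over [kappa(d_i)] is not visible on the formula, whose sum over a
    basis must be shown to commute with scalars; it is checked on coordinates. *)
Fact out_map_linear : linear (fun m : M i => dsum_mk (m_out m) : nbhd i (sp M)).
Proof.
move=> c m m'; apply: nbhd_eq => j ji; have ij : i != j by rewrite eq_sym.
rewrite linearP /= !dsum_mkK; apply: (coef_inj ij) => a k.
rewrite [RHS]raddfD /= coefZ //.
rewrite !coef_out // pure_additiver linearD; congr (_ + _).
under eq_bigr => l _ do rewrite coef_out //.
rewrite -pure_balanced.
have -> : arr_act (arr_elt a (bas D j i k)) c = \sum_l
    trK j i (vsval c * bas D j i k * dbas D j i l) *: arr_elt a (bas D j i l).
  have cE : vsval c \in ksub D (cdd C i j).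
    by rewrite (subvP (ksub_le D _ _) _ (valP c)) ?cdd_dvd ?dvdn_lcml.
  apply/ffunP => b; rewrite sum_ffunE ffunE; apply: val_inj.
  have xE : bas D j i k * vsval c \in ksub D (cdd C i j) by rewrite memvM ?bas_mem.
  rewrite -[LHS]/(kk_val _) in_kkK; last first.
    by rewrite memvM // arr_eltE ?bas_mem //; case: eqP; rewrite ?bas_mem ?mem0v.
  rewrite raddf_sum arr_eltE ?bas_mem //; case: (eqVneq b a) => [->|ba].
    rewrite (bas_exp ij xE); apply: eq_bigr => l _ /=.
    rewrite ffunE -[RHS]/(kk_val (_ *: arr_elt a (bas D j i l) a)).
    by rewrite kk_valZ arr_eltE ?bas_mem // eqxx [bas _ _ _ k * _]mulrC.
  rewrite mul0r big1 // => l _ /=.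
  rewrite ffunE -[LHS]/(kk_val (_ *: arr_elt a (bas D j i l) b)).
  by rewrite kk_valZ arr_eltE ?bas_mem // (negPf ba) mulr0.
rewrite pure_suml linear_sum; apply: eq_bigr => l _ /=.
by rewrite pureZl linearZ.
Qed.

Definition out_map : 'Hom(M i, nbhd i (sp M)) := hom_of out_map_linear.

Lemma out_mapE m j : dsum_at j (out_map m) = m_out m j.
Proof. by rewrite hom_ofE dsum_mkK. Qed.

Lemma in_single j (t : tens i (M j)) : j != i ->
  in_map (nbhd_single (V := sp M) t) = act M i j t *~ sgn D i j.
Proof.
move=> ji; rewrite in_mapE /m_in (bigD1 j) //= big1 ?addr0 ?dfwith_in //.
by move=> k /andP[_ kj]; rewrite dfwith_out 1?eq_sym // linear0 mul0rz.
Qed.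

End InOut.

Lemma act_tsub (M : rep D) (K : forall j, {vspace M j}) k j :
  (forall (e : arr D k j) m, m \in K j -> act M k j (pure e m) \in K k) ->
  forall t, tsub (K j) t -> act M k j t \in K k.
Proof.
move=> MK t /tsub_decomp[s ->]; rewrite linear_sum memv_suml // => l _ /=.
by apply/MK/subvsP.
Qed.

Lemma memv_sgn (V : vectType (kv D i)) (K : {vspace V}) j v : j != i ->
  v *~ sgn D i j \in K -> v \in K.
Proof.
move=> ji; have [] := @sgn_pm1 _ _ D i j; first by rewrite eq_sym.
  by move=> ->.
by move=> ->; rewrite mulrNz memvN.
Qed.

(** Splits the closure conditions according to whether an arrow avoids, enters or
    leaves [i]. *)
Lemma submoduleP (M : rep D) (K : forall j, {vspace M j}) :
  is_submodule K <->
  [/\ forall k j, k != i -> j != i -> forall (e : arr D k j) m,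
        m \in K j -> act M k j (pure e m) \in K k,
      forall b, b \in nbhd_sub i K -> in_map M b \in K i &
      forall m, m \in K i -> out_map M m \in nbhd_sub i K].
Proof.
split=> [MK|[off inK outK] k j e m mK].
  split=> [k j _ _|b /nbhd_subP bK|m mK]; first exact: MK.
    rewrite -(dsum_atK b) in_mapE memv_suml // => j ji.
    apply: rpredMz; apply: act_tsub (bK j ji) => e m; exact: MK.
  apply/nbhd_subP => j ji; rewrite out_mapE /m_out.
  by do 2![apply: sum_tsub => ?]; apply/pure_tsub/MK.
have [kj|kj] := eqVneq k j.
  subst k; rewrite (tens_loop (pure e m) 0).
  by rewrite linear0 mem0v.
have [ki|ki] := eqVneq k i.
  subst k; rename kj into ij; have ji : j != i by rewrite eq_sym.
  apply: (memv_sgn ji); rewrite -in_single //; apply: inK; apply/nbhd_subP => l li.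
  case: (eqVneq l j) => [->|lj]; first by rewrite nbhd_single_at; apply: pure_tsub.
  by rewrite nbhd_single_out //; exists 0; rewrite linear0.
have [ji|ji] := eqVneq j i; last exact: off.
subst j.
apply: out_act; first by rewrite eq_sym.
by have /nbhd_subP/(_ k ki) := outK m mK; rewrite out_mapE.
Qed.

(** The same trichotomy of arrows as for submodules. *)
Lemma morphismP (M N : rep D) (f : forall j, 'Hom(M j, N j)) :
  is_morphism f <->
  [/\ forall k j, k != i -> j != i -> forall t : tens k (M j),
        f k (act M k j t) = act N k j (tens_map (f j) t),
      forall b, f i (in_map M b) = in_map N (nbhd_map i f b) &
      forall m, nbhd_map i f (out_map M m) = out_map N (f i m)].
Proof.
split=> [fM|[off fin fout] k j t].
  split=> [k j _ _|b|m]; first exact: fM.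
    rewrite -(dsum_atK b) in_mapE -(dsum_atK (nbhd_map _ _ _)) in_mapE.
    rewrite linear_sum; apply: eq_bigr => j ji; rewrite raddfMz /= fM.
    by rewrite nbhd_mapE dsum_mkK.
  apply: nbhd_eq => j ji; rewrite nbhd_mapE !out_mapE.
  rewrite linear_sum; apply: eq_bigr => a _.
  rewrite linear_sum; apply: eq_bigr => k _ /=.
  by rewrite tens_map_pure fM tens_map_pure.
have [kj|kj] := eqVneq k j.
  subst k; rewrite (tens_loop t 0).
  by rewrite !linear0.
have [ki|ki] := eqVneq k i.
  subst k; rename kj into ij; have ji : j != i by rewrite eq_sym.
  have E : nbhd_map i f (nbhd_single (V := sp M) t) =
      nbhd_single (V := sp N) (tens_map (f j) t).
    apply: nbhd_eq => l li; rewrite nbhd_mapE.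
    case: (eqVneq l j) => [->|lj]; first by rewrite !nbhd_single_at.
    by rewrite !nbhd_single_out // linear0.
  have := fin (nbhd_single (V := sp M) t); rewrite E !in_single // raddfMz /=.
  have [] := @sgn_pm1 _ _ D i j ij => ->; first by [].
  by rewrite !mulrNz => /oppr_inj.
have [ji|ji] := eqVneq j i; last exact: off.
subst j; rewrite (tens_decomp t) [act M k i _]linear_sum [LHS]linear_sum.
rewrite [tens_map (f i) _]linear_sum [RHS]linear_sum.
apply: eq_bigr => l _ /=; rewrite tens_map_pure; apply: out_act_eq.
  by rewrite eq_sym.
by rewrite -!out_mapE -fout nbhd_mapE.
Qed.

End Vertex.

(** * Reflections and dimension vectors *)

Section Reflections.

Variables (R : realType) (n : nat) (C : symCartan n) (i : 'I_n).

Lemma srootE k : sroot R i 0 k = (k == i)%:R.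
Proof. by rewrite mxE eqxx. Qed.

Lemma form_scoroot (x : rspace R n) :
  form C (scoroot R C i) x = \sum_k (cA C i k)%:~R * x 0 k.
Proof.
rewrite /form (bigD1 i) //= [X in _ + X]big1 ?addr0 => [|k ki].
  have d0 : (cd C i)%:R != 0 :> R by rewrite pnatr_eq0 -lt0n cd_gt0.
  apply: eq_bigr => k _; rewrite mxE srootE eqxx mulr1.
  by rewrite [RHS]mulrC mulrACA mulVf // mul1r mulrC.
by rewrite big1 // => l _; rewrite mxE srootE (negPf ki) mulr0 !mul0r.
Qed.

Fact refl_fun_linear :
  linear (fun x : rspace R n => x - form C (scoroot R C i) x *: sroot R i).
Proof.
move=> c x y; rewrite scalerBr addrACA -opprD; congr (_ - _).
rewrite scalerA -scalerDl; congr (_ *: _).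
rewrite !form_scoroot mulr_sumr -big_split; apply: eq_bigr => k _ /=.
by rewrite !mxE mulrDr mulrCA.
Qed.

Lemma reflE (x : rspace R n) :
  refl R C i x = x - (\sum_k (cA C i k)%:~R * x 0 k) *: sroot R i.
Proof. by rewrite -form_scoroot; apply: (hom_ofE refl_fun_linear). Qed.

Lemma refl_sroot : refl R C i (sroot R i) = - sroot R i.
Proof.
rewrite reflE (bigD1 i) //= big1 => [|k ki].
  rewrite srootE eqxx mulr1 addr0 cA_diag.
  by rewrite -[X in X - _]scale1r -scalerBl -scaleN1r; congr (_ *: _); ring.
by rewrite srootE (negPf ki) mulr0.
Qed.

Lemma reflK : involutive (refl R C i).
Proof.
move=> x; rewrite [X in refl _ _ _ X]reflE linearB linearZ /= refl_sroot.
by rewrite [X in X - _]reflE scalerN opprK subrK.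
Qed.

Lemma dual_act_reflE (t : rdual R n) x : dual_act (refl R C i) t x = t (refl R C i x).
Proof.
rewrite comp_lfunE; congr (t _); apply: (can_inj reflK); rewrite reflK.
by apply: lker0_lfunVK; apply/lker0P; apply: can_inj reflK.
Qed.

Lemma dual_act_reflK : involutive (dual_act (refl R C i)).
Proof. by move=> t; apply/lfunP => x; rewrite !dual_act_reflE reflK. Qed.

Lemma dual_act_refl_sroot (t : rdual R n) :
  dual_act (refl R C i) t (sroot R i) = - t (sroot R i).
Proof. by rewrite dual_act_reflE refl_sroot linearN. Qed.

End Reflections.

Section DimensionVectors.

Variables (R : realType) (n : nat) (C : symCartan n) (D : preprojData C).

Lemma dimvecE (M : rep D) (K : forall j, {vspace M j}) k :
  dimvec R K 0 k = (\dim (K k))%:R.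
Proof.
rewrite summxE (bigD1 k) //= big1 => [|l lk].
  by rewrite mxE srootE eqxx mulr1 addr0.
by rewrite mxE srootE eq_sym (negPf lk) mulr0.
Qed.

(** The difference has no component off [i], and the reflection replaces the
    coordinate at [i] by the dimension of [J_di] minus that of [J_i]. *)
Lemma refl_dimvec i (M N : rep D) (J : forall j, {vspace M j})
    (K : forall j, {vspace N j}) :
  (forall j, j != i -> \dim (J j) = \dim (K j)) ->
  refl R C i (dimvec R J) = dimvec R K
    + ((\dim (nbhd_sub i J))%:R - (\dim (J i))%:R - (\dim (K i))%:R) *: sroot R i.
Proof.
move=> JK; apply/rowP => k; rewrite reflE !mxE !dimvecE eqxx /=.
have -> : \sum_l (cA C i l)%:~R * dimvec R J 0 l =
    2 * (\dim (J i))%:R - (\dim (nbhd_sub i J))%:R.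
  rewrite (bigD1 i) //= cA_diag dimvecE; congr (_ + _).
  rewrite dim_nbhd_sub natr_sum -sumrN; apply: eq_bigr => l li.
  rewrite dimvecE natrM -mulNr; congr (_ * _).
  have := cA_le0 C; move=> /(_ i l); rewrite eq_sym => /(_ li) A0.
  by rewrite -[X in - X]/((Posz `|cA C i l|)%:~R) abszE ler0_norm // rmorphN opprK.
case: eqVneq => [->|ki].
  by rewrite -[true%:R]/(1 : R) !mulr1; ring.
by rewrite !mulr0 subr0 addr0 JK.
Qed.

End DimensionVectors.

(** * Reflection pairs *)

Section Pair.

Variables (n : nat) (C : symCartan n) (D : preprojData C) (i : 'I_n).

(** The common shape of the two reflection functors: up to isomorphism [Q] is
    [Sigma_i^+ P] and [P] is [Sigma_i^- Q]. *)
Record reflection_pair (P Q : rep D) := ReflectionPair {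
  fwd : forall j, 'Hom(P j, Q j);
  bwd : forall j, 'Hom(Q j, P j);
  fwdK : forall j, j != i -> cancel (fwd j) (bwd j);
  bwdK : forall j, j != i -> cancel (bwd j) (fwd j);
  fwd_act : forall k j (t : tens k (P j)), k != i -> j != i ->
    fwd k (act P k j t) = act Q k j (tens_map (fwd j) t);
  in_onto : forall p, exists b, in_map i P b = p;
  out_inj : injective (out_map i Q);
  in_out_exact : forall b,
    in_map i P b = 0 <-> exists y, out_map i Q y = nbhd_map i fwd b;
  out_in_eq : forall b,
    out_map i Q (in_map i Q (nbhd_map i fwd b)) =
    nbhd_map i fwd (out_map i P (in_map i P b))
}.

Section Transport.

Variables (P Q : rep D) (r : reflection_pair P Q).

Local Notation F := (nbhd_map i (fwd r)).
Local Notation G := (nbhd_map i (bwd r)).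

Lemma nbhd_fwdK : cancel F G. Proof. by apply: nbhd_map_can; apply: fwdK. Qed.
Lemma nbhd_bwdK : cancel G F. Proof. by apply: nbhd_map_can; apply: bwdK. Qed.

Lemma bwd_act k j (t : tens k (Q j)) : k != i -> j != i ->
  bwd r k (act Q k j t) = act P k j (tens_map (bwd r j) t).
Proof.
move=> ki ji; apply: (can_inj (fwdK r ki)); rewrite fwd_act // bwdK //.
by rewrite tens_map_can //; apply: bwdK.
Qed.

Lemma dim_fwd j (V : {vspace P j}) : j != i -> \dim (fwd r j @: V) = \dim V.
Proof.
move=> ji; rewrite limg_dim_eq //.
by have /can_inj/lker0P/eqP -> := fwdK r ji; rewrite capv0.
Qed.

Lemma dim_bwd j (V : {vspace Q j}) : j != i -> \dim (bwd r j @: V) = \dim V.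
Proof.
move=> ji; rewrite limg_dim_eq //.
by have /can_inj/lker0P/eqP -> := bwdK r ji; rewrite capv0.
Qed.

(** The map onto [P_i], with source moved to [Q_di] so that the exact sequence lives
    in one space. *)
Definition in_map_bwd : 'Hom(nbhd i (sp Q), P i) := (in_map i P \o G)%VF.

Lemma limg_out : limg (out_map i Q) = lker in_map_bwd.
Proof.
apply/vspaceP => x; rewrite memv_ker comp_lfunE.
apply/idP/eqP => [/memv_imgP[y _ ->]|].
  by apply/(in_out_exact r); exists y; rewrite nbhd_bwdK.
by case/(in_out_exact r) => y; rewrite nbhd_bwdK => <-; rewrite memv_img ?memvf.
Qed.

(** The exact sequence restricted to a subspace [T] of its middle term. *)
Lemma dim_split (T : {vspace nbhd i (sp Q)}) :
  (\dim (out_map i Q @^-1: T) + \dim (in_map_bwd @: T) = \dim T)%N.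
Proof.
rewrite dim_limg_preim ?limg_out ?limg_ker_dim //; exact: out_inj r.
Qed.

Lemma dim_nbhd_pair : (\dim {:Q i} + \dim {:P i} = \dim {:nbhd i (sp Q)})%N.
Proof.
have <- : (out_map i Q @^-1: fullv)%VS = fullv.
  by apply/vspaceP => y; rewrite -memv_preim !memvf.
have <- : (in_map_bwd @: fullv)%VS = fullv; last exact: dim_split.
apply/vspaceP => p; rewrite memvf; have [b <-] := in_onto r p.
rewrite -(nbhd_fwdK b).
by have := memv_img in_map_bwd (memvf (F b)); rewrite comp_lfunE.
Qed.

Definition pull (K : forall j, {vspace Q j}) : forall j, {vspace P j} :=
  dfwith (fun j => bwd r j @: K j)%VS (in_map_bwd @: nbhd_sub i K)%VS.

Definition push (J : forall j, {vspace P j}) : forall j, {vspace Q j} :=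
  dfwith (fun j => fwd r j @: J j)%VS (out_map i Q @^-1: (F @: nbhd_sub i J))%VS.

Lemma pull_at K : pull K i = (in_map_bwd @: nbhd_sub i K)%VS.
Proof. exact: dfwith_in. Qed.

Lemma pull_off K j : j != i -> pull K j = (bwd r j @: K j)%VS.
Proof. by move=> ji; rewrite /pull dfwith_out // eq_sym. Qed.

Lemma push_at J : push J i = (out_map i Q @^-1: (F @: nbhd_sub i J))%VS.
Proof. exact: dfwith_in. Qed.

Lemma push_off J j : j != i -> push J j = (fwd r j @: J j)%VS.
Proof. by move=> ji; rewrite /push dfwith_out // eq_sym. Qed.

Lemma pull_submodule K : is_submodule K -> is_submodule (pull K).
Proof.
move=> /(submoduleP i)[off inK outK]; apply/(submoduleP i); split.
- move=> k j ki ji e m; rewrite !pull_off // => /memv_imgP[m' m'K ->].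
  by rewrite -tens_map_pure -bwd_act // memv_img // off.
- move=> b bK; rewrite pull_at -(nbhd_fwdK b) -comp_lfunE memv_img //.
  apply: nbhd_sub_map bK => j ji u; rewrite pull_off // => /memv_imgP[v vK ->].
  by rewrite bwdK.
move=> m; rewrite pull_at => /memv_imgP[x xK ->].
rewrite comp_lfunE -(nbhd_fwdK (out_map _ _ _)) -out_in_eq nbhd_bwdK.
apply: nbhd_sub_map (outK _ (inK _ xK)) => j ji u uK.
by rewrite pull_off // memv_img.
Qed.

Lemma push_submodule J : is_submodule J -> is_submodule (push J).
Proof.
move=> /(submoduleP i)[off inJ outJ]; apply/(submoduleP i); split.
- move=> k j ki ji e m; rewrite !push_off // => /memv_imgP[m' m'J ->].
  by rewrite -tens_map_pure -fwd_act // memv_img // off.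
- move=> b bJ; rewrite push_at -memv_preim -(nbhd_bwdK b) out_in_eq memv_img //.
  apply/outJ/inJ; apply: nbhd_sub_map bJ => j ji u.
  by rewrite push_off // => /memv_imgP[v vJ ->]; rewrite fwdK.
move=> m; rewrite push_at -memv_preim => /memv_imgP[x xJ ->].
by apply: nbhd_sub_map xJ => j ji u uJ; rewrite push_off // memv_img.
Qed.

Section Stability.

Variable R : realType.
Implicit Type t : rdual R n.

Local Notation s := (dual_act (refl R C i)).

(** The gap at [i] is that between [K_i] and the largest subspace of [Q_i] that the
    out-map sends into [K_di]. *)
Lemma refl_dimvec_pull K : is_submodule K -> exists2 c : R, 0 <= c &
  refl R C i (dimvec R K) = dimvec R (pull K) + c *: sroot R i.
Proof.
move=> /(submoduleP i)[_ _ outK].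
rewrite (refl_dimvec _ _ (K := pull K)) => [|j ji]; last by rewrite pull_off ?dim_bwd.
eexists; last by [].
rewrite pull_at -(dim_split (nbhd_sub i K)) natrD addrAC addrK subr_ge0 ler_nat.
by apply: dimvS; apply/subvP => m /outK; rewrite memv_preim.
Qed.

(** The gap at [i] is that between [J_i] and the image of [J_di] under the in-map. *)
Lemma refl_dimvec_push J : is_submodule J -> exists2 c : R, 0 <= c &
  refl R C i (dimvec R J) = dimvec R (push J) - c *: sroot R i.
Proof.
move=> /(submoduleP i)[_ inJ _].
rewrite (refl_dimvec _ _ (K := push J)) => [|j ji]; last by rewrite push_off ?dim_fwd.
exists ((\dim (J i))%:R - (\dim (in_map_bwd @: (F @: nbhd_sub i J)))%:R).
  rewrite subr_ge0 ler_nat; apply: dimvS; apply/subvP => x.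
  by case/memv_imgP => _ /memv_imgP[y yJ ->] ->; rewrite comp_lfunE nbhd_fwdK inJ.
rewrite push_at -scaleNr opprB; congr (_ + _ *: _).
have -> : \dim (nbhd_sub i J) = \dim (F @: nbhd_sub i J).
  by rewrite limg_dim_eq //; have /can_inj/lker0P/eqP -> := nbhd_fwdK; rewrite capv0.
by rewrite -(dim_split (F @: _)) natrD; ring.
Qed.

Lemma refl_dimvec_full :
  refl R C i (dimvec R (fun j => {:P j}%VS)) = dimvec R (fun j => {:Q j}%VS).
Proof.
rewrite (refl_dimvec _ _ (K := fun j => {:Q j}%VS)) => [|j ji].
  have -> : \dim (nbhd_sub i (fun j => {:P j}%VS)) = \dim {:nbhd i (sp Q)}.
    rewrite dim_nbhd_sub dim_nbhd; apply: eq_bigr => j ji; congr muln.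
    rewrite -(dim_fwd _ ji); congr (\dim _); apply/eqP; rewrite eqEsubv subvf.
    by apply/subvP => y _; rewrite -(bwdK r ji y) memv_img ?memvf.
  by rewrite -dim_nbhd_pair natrD addrK subrr scale0r addr0.
rewrite -(dim_fwd _ ji); congr (\dim _); apply/eqP; rewrite eqEsubv subvf.
by apply/subvP => y _; rewrite -(bwdK r ji y) memv_img ?memvf.
Qed.

End Stability.
End Transport.

End Pair.

(** * Stability domains *)

Section Stability.

Variables (n : nat) (C : symCartan n) (D : preprojData C) (i : 'I_n).
Variables (R : realType) (P Q : fdmod D) (r : reflection_pair i P Q).
Implicit Type t : rdual R n.

Local Notation s := (dual_act (refl R C i)).

Lemma semistable_fwd t : semistable t P -> 0 <= t (sroot R i) -> semistable (s t) Q.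
Proof.
case=> t0 tP ti; split; first by rewrite dual_act_reflE -(refl_dimvec_full r) reflK.
move=> K KQ; rewrite dual_act_reflE; have [c c0 ->] := refl_dimvec_pull r R KQ.
rewrite linearD linearZ addr_ge0 ?mulr_ge0 //.
exact/tP/pull_submodule.
Qed.

Lemma semistable_bwd t : semistable t Q -> t (sroot R i) <= 0 -> semistable (s t) P.
Proof.
case=> t0 tQ ti; split; first by rewrite dual_act_reflE (refl_dimvec_full r).
move=> J JP; rewrite dual_act_reflE; have [c c0 ->] := refl_dimvec_push r R JP.
rewrite linearB linearZ addr_ge0 //; first exact/tQ/push_submodule.
by rewrite oppr_ge0 mulr_ge0_le0.
Qed.

(** The rank of the in-map of [Q] equals that of out o in, hence is at most
    [dim P_i]. A hyperplane of [Q_i] above its image, with all of [Q] off [i], is a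
    submodule whose quotient is the simple module at [i]. *)
Lemma quotient_bound t :
  (\dim {:P i} < \dim {:Q i})%N -> semistable t Q -> t (sroot R i) <= 0.
Proof.
move=> PQ [t0 tQ].
have rk : (\dim (limg (in_map i Q)) <= \dim {:P i})%N.
  have /lker0P/eqP o0 := out_inj r.
  rewrite -(@limg_dim_eq _ _ _ (out_map i Q)); last by rewrite o0 capv0.
  have sub : (out_map i Q @: limg (in_map i Q) <=
      (nbhd_map i (fwd r) \o out_map i P) @: fullv)%VS.
    apply/subvP => _ /memv_imgP[_ /memv_imgP[b _ ->] ->].
    by rewrite -(nbhd_bwdK r b) (out_in_eq r) -comp_lfunE memv_img ?memvf.
  rewrite (leq_trans (dimvS sub)) //.
  by rewrite -[leqRHS](limg_ker_dim (nbhd_map i (fwd r) \o out_map i P)%VF) leq_addl.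
have [H inH dH] : exists2 H : {vspace Q i},
    (limg (in_map i Q) <= H)%VS & (\dim H).+1 = \dim {:Q i}.
  apply: exists_hyperplane; apply: contraL PQ => /eqP inQ.
  by rewrite -leqNgt -inQ.
pose K : forall j, {vspace Q j} := dfwith (fun j => {:Q j}%VS) H.
have Ki : K i = H by apply: dfwith_in.
have Kj j : j != i -> K j = {:Q j}%VS.
  by move=> ji; rewrite /K dfwith_out // eq_sym.
have KQ : is_submodule K.
  apply/(submoduleP i); split=> [k j ki _ e m _|b _|m _]; first by rewrite Kj ?memvf.
    by rewrite Ki (subvP inH) ?memv_img ?memvf.
  by apply/nbhd_subP => j ji; rewrite Kj //; apply: tsub_full.
have E : dimvec R (fun j => {:Q j}%VS) = dimvec R K + sroot R i.
  apply/rowP => k; rewrite mxE srootE !dimvecE.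
  case: eqVneq => [->|ki]; last by rewrite Kj // addr0.
  by rewrite Ki -dH -addn1 natrD.
move: t0; rewrite E linearD addrC => /eqP; rewrite addr_eq0 => /eqP ->.
by rewrite oppr_le0; apply: tQ.
Qed.

(** Dual to the previous bound: the rank of the out-map of [P] is at most
    [dim Q_i], and a line in its kernel is a copy of the simple module at [i]. *)
Lemma submodule_bound t :
  (\dim {:Q i} < \dim {:P i})%N -> semistable t P -> 0 <= t (sroot R i).
Proof.
move=> QP [_ tP].
have rk : (\dim (limg (out_map i P)) <= \dim {:Q i})%N.
  have sub : (limg (out_map i P) <=
      (nbhd_map i (bwd r) \o out_map i Q) @: fullv)%VS.
    apply/subvP => _ /memv_imgP[p _ ->]; have [b <-] := in_onto r p.
    rewrite -(nbhd_fwdK r (out_map _ _ _)) -(out_in_eq r).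
    by rewrite -comp_lfunE memv_img ?memvf.
  rewrite (leq_trans (dimvS sub)) //.
  by rewrite -[leqRHS](limg_ker_dim (nbhd_map i (bwd r) \o out_map i Q)%VF) leq_addl.
have ker0 : lker (out_map i P) != 0%VS.
  apply: contraL QP => /eqP o0.
  by rewrite -leqNgt -(@limg_dim_eq _ _ _ (out_map i P)) // o0 capv0.
pose v := vpick (lker (out_map i P)).
have v0 : v != 0 by rewrite vpick0.
have ov : out_map i P v = 0 by apply/eqP; rewrite -memv_ker memv_pick.
pose K : forall j, {vspace P j} := dfwith (fun j => 0%VS) <[v]>%VS.
have Ki : K i = <[v]>%VS by apply: dfwith_in.
have Kj j : j != i -> K j = 0%VS.
  by move=> ji; rewrite /K dfwith_out // eq_sym.
have KP : is_submodule K.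
  apply/(submoduleP i); split=> [k j ki ji e m|b /nbhd_subP bK|m].
  - by rewrite (Kj j) // memv0 => /eqP ->; rewrite pure0r linear0 mem0v.
  - have -> : b = 0; last by rewrite linear0 mem0v.
    apply: nbhd_eq => j ji; rewrite linear0; apply: tsub0.
    by rewrite -(Kj j ji); apply: bK.
  by rewrite Ki => /vlineP[c ->]; rewrite linearZ /= ov scaler0 mem0v.
have <- : dimvec R K = sroot R i; last exact: tP.
apply/rowP => k; rewrite srootE dimvecE.
case: eqVneq => [->|ki]; last by rewrite Kj ?dimv0.
by rewrite Ki dim_vline v0.
Qed.

End Stability.

(** * Bricks *)

Section Morphisms.

Variables (n : nat) (C : symCartan n) (D : preprojData C).

Lemma is_morphism_comp (L M N : rep D) (f : forall j, 'Hom(L j, M j))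
    (g : forall j, 'Hom(M j, N j)) :
  is_morphism f -> is_morphism g -> is_morphism (fun j => g j \o f j)%VF.
Proof. by move=> fM gM k j t; rewrite comp_lfunE fM gM tens_map_comp. Qed.

Lemma is_morphism_id (M : rep D) : @is_morphism _ _ _ M M (fun j => \1%VF).
Proof.
by move=> k j t; rewrite id_lfunE tens_map_id // => x; rewrite id_lfunE.
Qed.

Lemma is_morphism0 (M N : rep D) : @is_morphism _ _ _ M N (fun j => 0).
Proof.
move=> k j t; rewrite zero_lfunE (_ : tens_map _ _ = 0) ?linear0 //.
by rewrite /tens_map big1 // => l _; rewrite zero_lfunE pure0r.
Qed.

Variable i : 'I_n.

Definition rigid_off (M : rep D) : Prop :=
  forall f g : (forall j, 'End(M j)), is_morphism f -> is_morphism g ->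
  (forall j, j != i -> f j = g j) -> f i = g i.

Definition lifts_off (A B : rep D) (a : forall j, 'Hom(A j, B j))
    (b : forall j, 'Hom(B j, A j)) : Prop :=
  forall f : (forall j, 'End(A j)), is_morphism f ->
  exists2 g : (forall j, 'End(B j)), is_morphism g &
    forall j, j != i -> g j = (a j \o f j \o b j)%VF.

(** Stated for abstract [A] and [B] so that it serves both directions of a
    reflection pair. Inverses lift to inverses, and the lift of a nonzero
    endomorphism is nonzero, because endomorphisms are determined off [i]. *)
Lemma brick_transfer (A B : fdmod D) (a : forall j, 'Hom(A j, B j))
    (b : forall j, 'Hom(B j, A j)) :
  (forall j, j != i -> cancel (a j) (b j)) ->
  (forall j, j != i -> cancel (b j) (a j)) ->
  rigid_off A -> rigid_off B -> lifts_off a b -> lifts_off b a ->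
  brick A -> brick B.
Proof.
move=> aK bK rA rB ab ba [[k [m m0]] Ainv]; split.
  apply: contrapT => B0.
  have B0' j (x : B j) : x = 0.
    by apply/eqP; apply: contrapT => /negP x0; apply: B0; exists j, x.
  have id0 j : j != i -> \1%VF = 0 :> 'End(A j).
    move=> ji; apply/lfunP => x; apply: (can_inj (aK j ji)).
    by rewrite [LHS]B0' [RHS]B0'.
  have E : \1%VF = 0 :> 'End(A k).
    have [->|] := eqVneq k i; last exact: id0.
    exact: (rA _ _ (@is_morphism_id A) (@is_morphism0 A A) id0).
  by move/lfunP/(_ m)/eqP: E; rewrite id_lfunE zero_lfunE (negPf m0).
move=> g gB gN; have [f fA fg] := ba g gB.
have gE j : j != i -> g j = (a j \o f j \o b j)%VF.
  move=> ji; apply/lfunP => x; rewrite fg // !comp_lfunE.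
  by rewrite !(bK j ji).
have fN : ~ (forall j, f j = 0).
  move=> f0; apply: gN => j.
  have g0 l : l != i -> g l = 0.
    by move=> li; rewrite gE // f0 comp_lfun0r comp_lfun0l.
  have [->|] := eqVneq j i; last exact: g0.
  exact: (rB _ _ gB (@is_morphism0 B B) g0).
have [f' f'A ff'] := Ainv f fA fN.
have [g' g'B g'E] := ab f' f'A.
exists g' => // j.
have gg' l : l != i -> (g l \o g' l = \1)%VF /\ (g' l \o g l = \1)%VF.
  move=> li; have [/lfunP E1 /lfunP E2] := ff' l.
  split; apply/lfunP => x; rewrite gE // g'E // !comp_lfunE (aK l li).
    by have := E1 (b l x); rewrite comp_lfunE !id_lfunE => ->; apply: bK.
  by have := E2 (b l x); rewrite comp_lfunE !id_lfunE => ->; apply: bK.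
have [->|] := eqVneq j i; last exact: gg'.
split.
  apply: (rB _ _ (is_morphism_comp g'B gB) (@is_morphism_id B)) => l /gg'[E _].
  exact: E.
apply: (rB _ _ (is_morphism_comp gB g'B) (@is_morphism_id B)) => l /gg'[_ E].
exact: E.
Qed.

Section PairBricks.

Variables (P Q : rep D) (r : reflection_pair i P Q).

Local Notation F := (nbhd_map i (fwd r)).
Local Notation G := (nbhd_map i (bwd r)).

(** The in-map of [P] is onto, so it determines the component at [i]. *)
Lemma rigid_source : rigid_off P.
Proof.
move=> f g /(morphismP i)[_ fin _] /(morphismP i)[_ gin _] fg.
apply/lfunP => p; have [b <-] := in_onto r p.
by rewrite fin gin (nbhd_map_ext _ fg).
Qed.

(** The out-map of [Q] is injective, so it determines the component at [i]. *)
Lemma rigid_target : rigid_off Q.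
Proof.
move=> f g /(morphismP i)[_ _ fout] /(morphismP i)[_ _ gout] fg.
apply/lfunP => p; apply: (out_inj r).
by rewrite -fout -gout (nbhd_map_ext _ fg).
Qed.

(** The endomorphism induced on [Q_di] preserves the kernel of the map onto [P_i],
    that is [Q_i]; its restriction is the missing component. *)
Lemma lifts_fwd : lifts_off (fwd r) (bwd r).
Proof.
move=> f /(morphismP i)[foff fin fout].
have [h hE] : exists h : 'End(nbhd i (sp Q)), forall x, h x = F (nbhd_map i f (G x)).
  by exists (F \o nbhd_map i f \o G)%VF => x; rewrite !comp_lfunE.
pose g_i := ((out_map i Q)^-1 \o h \o out_map i Q)%VF.
have g_out x : out_map i Q (g_i x) = h (out_map i Q x).
  rewrite /g_i !comp_lfunE; apply: limg_lfunVK.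
  rewrite (limg_out r) memv_ker comp_lfunE hE nbhd_fwdK -fin.
  suff -> : in_map i P (G (out_map i Q x)) = 0 by rewrite linear0.
  by apply/(in_out_exact r); exists x; rewrite nbhd_bwdK.
pose g : forall j, 'End(Q j) := dfwith (fun j => fwd r j \o f j \o bwd r j)%VF g_i.
have gi : g i = g_i by apply: dfwith_in.
have gj j : j != i -> g j = (fwd r j \o f j \o bwd r j)%VF.
  by move=> ji; rewrite /g dfwith_out // eq_sym.
have gN b : nbhd_map i g b = h b.
  apply: nbhd_eq => j ji; rewrite hE !nbhd_mapE !tens_map_comp.
  by rewrite gj // comp_lfunA.
exists g => //; apply/(morphismP i); split.
- move=> k j ki ji t; rewrite !gj // !comp_lfunE bwd_act // foff // fwd_act //.
  by rewrite -!tens_map_comp.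
- move=> b; apply: (out_inj r); rewrite gi gN g_out !hE (out_in_eq r).
  have bE : b = F (G b) by rewrite nbhd_bwdK.
  by rewrite [in LHS]bE (out_in_eq r (G b)) nbhd_fwdK fout fin.
by move=> m; rewrite gN gi g_out.
Qed.

(** The endomorphism induced on [P_di] preserves the kernel [Q_i] of the in-map and
    therefore descends to [P_i]. *)
Lemma lifts_bwd : lifts_off (bwd r) (fwd r).
Proof.
move=> g /(morphismP i)[goff gin gout].
have [h hE] : exists h : 'End(nbhd i (sp P)), forall x, h x = G (nbhd_map i g (F x)).
  by exists (G \o nbhd_map i g \o F)%VF => x; rewrite !comp_lfunE.
pose f_i := (in_map i P \o h \o (in_map i P)^-1)%VF.
have f_in b : f_i (in_map i P b) = in_map i P (h b).
  rewrite /f_i !comp_lfunE; apply/eqP; rewrite -subr_eq0 -!linearB /=; apply/eqP.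
  apply/(in_out_exact r).
  (* A preimage of the value of the in-map at b differs from b by an element of the
     kernel, which is the image of Q_i. *)
  set d := _ - b.
  have : in_map i P d = 0.
    by rewrite linearB /= limg_lfunVK ?subrr // memv_img ?memvf.
  case/(in_out_exact r) => y yd; exists (g i y).
  by rewrite hE nbhd_bwdK -gout yd.
pose f : forall j, 'End(P j) := dfwith (fun j => bwd r j \o g j \o fwd r j)%VF f_i.
have fi : f i = f_i by apply: dfwith_in.
have fj j : j != i -> f j = (bwd r j \o g j \o fwd r j)%VF.
  by move=> ji; rewrite /f dfwith_out // eq_sym.
have fN b : nbhd_map i f b = h b.
  apply: nbhd_eq => j ji; rewrite hE !nbhd_mapE !tens_map_comp.
  by rewrite fj // comp_lfunA.
exists f => //; apply/(morphismP i); split.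
- move=> k j ki ji t; rewrite !fj // !comp_lfunE fwd_act // goff // bwd_act //.
  by rewrite -!tens_map_comp.
- by move=> b; rewrite fi fN f_in.
move=> m; have [b <-] := in_onto r m; rewrite fN fi f_in !hE.
apply: (can_inj (nbhd_fwdK r)); rewrite nbhd_bwdK -(out_in_eq r) gout gin.
by rewrite -(out_in_eq r) nbhd_bwdK.
Qed.

End PairBricks.

Lemma brick_fwd (P Q : fdmod D) (r : reflection_pair i P Q) : brick P -> brick Q.
Proof.
exact: brick_transfer (fwdK r) (bwdK r) (rigid_source r) (rigid_target r)
  (lifts_fwd r) (lifts_bwd r).
Qed.

Lemma brick_bwd (P Q : fdmod D) (r : reflection_pair i P Q) : brick Q -> brick P.
Proof.
exact: brick_transfer (bwdK r) (fwdK r) (rigid_target r) (rigid_source r)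
  (lifts_bwd r) (lifts_fwd r).
Qed.

End Morphisms.

(** * Simple modules *)

Section Simple.

Variables (n : nat) (C : symCartan n) (D : preprojData C).

Lemma rV0_eq (F : fieldType) (b : bool) (x y : 'rV[F]_b) : ~~ b -> x = y.
Proof. by case: b x y => // x y _; rewrite !thinmx0. Qed.

Lemma rV1_const (F : fieldType) (b : bool) (x : 'rV[F]_b) : b ->
  exists c, x = const_mx c.
Proof.
case: b x => // x _; exists (x 0 0).
by apply/rowP => k; rewrite mxE; congr (x _ _); apply: ord1.
Qed.

Lemma rV_sum_inj (F : fieldType) (b : bool) (x y : 'rV[F]_b) :
  \sum_l x 0 l = \sum_l y 0 l -> x = y.
Proof.
case: b x y => x y; last by move=> _; apply: rV0_eq.
by rewrite !big_ord1 => xy; apply/rowP => l; rewrite (ord1 l).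
Qed.

Lemma out0_act (M : rep D) k (m : M k) : out_map k M m = 0 ->
  forall j (e : arr D j k), act M j k (pure e m) = 0.
Proof.
move=> m0 j e; have [jk|jk] := eqVneq j k.
  by subst j; rewrite (tens_loop (pure e m) 0) linear0.
apply/eqP; rewrite -memv0; apply: out_act; first by rewrite eq_sym.
by rewrite -out_mapE m0 linear0; exists 0; rewrite linear0.
Qed.

(** A vector killed by the out-map is killed by every arrow, so it spans a copy of
    the simple module. *)
Lemma no_sub_inj i (M : fdmod D) : no_sub i M -> injective (out_map i M).
Proof.
move=> noS; apply/lker0P; apply: contrapT => /negP ker0; apply: noS.
(* Choosing a vector at every vertex avoids a transport along k = i: the simple
   module vanishes at the others. *)
pose v k := vpick (lker (out_map k M)).
have ov k : out_map k M (v k) = 0 by apply/eqP; rewrite -memv_ker memv_pick.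
have fL k : linear (fun x : simple D i k =>
    (\sum_l (x : 'rV[kv D k]_(k == i)) 0 l) *: v k : M k).
  move=> c x y; rewrite scalerA -scalerDl; congr (_ *: _).
  by rewrite mulr_sumr -big_split; apply: eq_bigr => l _; rewrite !mxE.
exists (fun k => hom_of (fL k)).
  move=> k j t; rewrite zero_lfunE linear0 /tens_map linear_sum big1 // => l _.
  by rewrite /= hom_ofE -pure_balanced (out0_act (ov j)).
move=> k x y; rewrite !hom_ofE; have [ki|ki] := orP (orbN (k == i)); last first.
  by move=> _; apply: rV0_eq.
have v0 : v k != 0 by rewrite vpick0 (eqP ki).
move/eqP; rewrite -subr_eq0 -scalerBl scaler_eq0 (negPf v0) orbF subr_eq0.
by move/eqP; apply: rV_sum_inj.
Qed.

(** A functional on [M_i] that vanishes on the image of the in-map is a quotient map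
    onto the simple module. *)
Lemma no_quot_onto i (M : fdmod D) : no_quot i M ->
  forall p, exists b, in_map i M b = p.
Proof.
move=> noQ; apply: limg_surj; apply: contrapT => /eqP inM; apply: noQ.
have hP k : exists h : 'Hom(M k, (kv D k)^o),
    (limg (in_map k M) != fullv -> exists v, h v = 1) /\
    (forall w, w \in limg (in_map k M) -> h w = 0).
  have [->|/limg_notin[v vM]] := eqVneq (limg (in_map k M)) fullv.
    by exists 0; split=> // w _; rewrite zero_lfunE.
  by have [h [hv h0]] := exists_functional vM; exists h; split=> // _; exists v.
pose h k := sval (cid (hP k)).
have [h1 h0] := all_and2 (fun k => svalP (cid (hP k))).
have fL k : linear (fun m : M k => const_mx (h k m) : simple D i k).
  by move=> c x y; apply/rowP => l; rewrite linearP !mxE.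
exists (fun k => hom_of (fL k)).
  move=> k j t; rewrite zero_lfunE hom_ofE.
  suff -> : h k (act M k j t) = 0 by apply/rowP => l; rewrite !mxE.
  have [kj|kj] := eqVneq k j.
    by subst k; rewrite (tens_loop t 0) !linear0.
  apply: (h0 k); have jk : j != k by rewrite eq_sym.
  by apply: (memv_sgn jk); rewrite -in_single // memv_img ?memvf.
move=> k s; have [ki|ki] := orP (orbN (k == i)); last by exists 0; apply: rV0_eq.
have [c ->] := rV1_const s ki.
have [v hv] : exists v, h k v = 1 by apply: (h1 k); rewrite (eqP ki).
exists (c *: v); rewrite hom_ofE linearZ /= hv; congr const_mx.
exact: mulr1.
Qed.

Lemma dim_simple i k : \dim {:simple D i k} = (k == i).
Proof. by rewrite dimvf dim_matrix; apply: mul1n. Qed.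

(** At [i] the module is a line, so a nonzero endomorphism is injective there. *)
Lemma brick_simple i : brick (simple D i).
Proof.
have E : (i == i) = true by rewrite eqxx.
split.
  exists i, (const_mx 1); apply/eqP => /rowP.
  have l : 'I_(i == i) by rewrite E; apply: ord0.
  by move/(_ l)/eqP; rewrite !mxE oner_eq0.
move=> f fM fN.
have fi : injective (f i).
  apply/lker0P; apply: contrapT => /negP ker0; apply: fN => k.
  apply/lfunP => x; rewrite zero_lfunE.
  have [ki|ki] := eqVneq k i; last by apply: rV0_eq.
  subst k; pose v := vpick (lker (f i)).
  have v0 : v != 0 by rewrite vpick0.
  have fv : f i v = 0 by apply/eqP; rewrite -memv_ker memv_pick.
  have [c xE] := rV1_const x E; have [d vE] := rV1_const v E.
  have d0 : d != 0.
    by apply: contra v0 => /eqP d0; rewrite vE d0; apply/eqP/rowP => l; rewrite !mxE.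
  have -> : x = (c / d) *: v.
    by rewrite xE vE; apply/rowP => l; rewrite !mxE divfK.
  by rewrite linearZ /= fv scaler0.
have inj k : lker (f k) == 0%VS.
  apply/lker0P; have [ki|ki] := eqVneq k i; first by subst k.
  by move=> x y _; apply: rV0_eq.
exists (fun k => (f k)^-1%VF) => [k j t|k].
  by rewrite !zero_lfunE linear0.
by split; [apply: lker0_compfV | apply: lker0_compVf].
Qed.

Lemma stab_simple (R : realType) i : Stab R (simple D i) = perp (sroot R i).
Proof.
have dE (K : forall k, {vspace simple D i k}) :
    dimvec R K = (\dim (K i))%:R *: sroot R i.
  apply/rowP => k; rewrite mxE srootE dimvecE.
  case: eqVneq => [->|ki]; first by rewrite mulr1.
  rewrite mulr0; apply/eqP; rewrite pnatr_eq0 -leqn0.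
  by rewrite (leq_trans (dimvS (subvf _))) // dim_simple (negPf ki).
apply/seteqP; split=> t.
  by case; rewrite dE dim_simple eqxx scale1r.
move=> t0; split=> [|K _]; rewrite dE linearZ /= t0.
  exact: mulr0.
by rewrite (_ : _ *: _ = 0) //; apply: mulr0.
Qed.

End Simple.

(** * The reflection functors *)

Section Sigma.

Variables (n : nat) (C : symCartan n) (D : preprojData C) (i : 'I_n).

Lemma bd_mapE (M N : rep D) (f : forall j, 'Hom(M j, N j)) (b : nbhd i (sp M)) j :
  bd_map f (fun k => dsum_at k b) j = dsum_at j (nbhd_map i f b).
Proof. by rewrite nbhd_mapE. Qed.

Lemma Sigma_pos_pair (M N : fdmod D) :
  is_Sigma_pos i M N -> exists _ : reflection_pair i M N, True.
Proof.
case=> /no_quot_onto onto [phi [iota [[bij off] iI ker out_iota in_iota]]].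
pose psi j := ((phi j)^-1)%VF.
have phiK j : j != i -> cancel (phi j) (psi j) by move=> /bij /bij_inv[].
have psiK j : j != i -> cancel (psi j) (phi j) by move=> /bij /bij_inv[].
have PhiK := nbhd_map_can phiK; have PsiK := nbhd_map_can psiK.
have outE y : nbhd_map i phi (out_map i N y) = dsum_mk (fun j => iota j y).
  apply: dsum_eq => j; rewrite dsum_mkK -out_iota nbhd_mapE out_mapE //.
suff r : reflection_pair i M N by exists r.
apply: (@ReflectionPair _ _ _ _ M N psi phi) => //.
- move=> k j t ki ji; apply: (can_inj (phiK k ki)); rewrite psiK // off //.
  by rewrite tens_map_can //; apply: psiK.
- move=> y y' /(congr1 (nbhd_map i phi)); rewrite !outE => yy'.
  by apply: iI => j; have := congr1 (dsum_at j) yy'; rewrite !dsum_mkK.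
- move=> b; rewrite -{1}(dsum_atK b) in_mapE ker; split=> -[y yb]; exists y.
    apply: (can_inj PhiK); rewrite outE PsiK.
    by apply: dsum_eq => j; rewrite dsum_mkK yb.
  move=> j; have := congr1 (dsum_at j) (outE y).
  by rewrite yb PsiK dsum_mkK.
move=> b; apply: (can_inj PhiK); rewrite outE PsiK.
apply: dsum_eq => j; rewrite dsum_mkK out_mapE.
have := in_iota (fun k => dsum_at k (nbhd_map i psi b)) j.
have -> : m_in (fun k => dsum_at k (nbhd_map i psi b)) = in_map i N (nbhd_map i psi b).
  by rewrite -in_mapE dsum_atK.
move=> ->; congr (m_out _ j).
rewrite -in_mapE; congr (in_map i M _); apply: dsum_eq => k.
by rewrite dsum_mkK bd_mapE PsiK.
Qed.

Lemma Sigma_neg_pair (M N : fdmod D) :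
  is_Sigma_neg i M N -> exists _ : reflection_pair i N M, True.
Proof.
case=> /no_sub_inj inj [phi [pr [[bij off] onto ker in_pr out_pr]]].
pose psi j := ((phi j)^-1)%VF.
have phiK j : j != i -> cancel (phi j) (psi j) by move=> /bij /bij_inv[].
have psiK j : j != i -> cancel (psi j) (phi j) by move=> /bij /bij_inv[].
have PhiK := nbhd_map_can phiK; have PsiK := nbhd_map_can psiK.
have inE b : in_map i N b = \sum_(j | j != i) pr j (dsum_at j (nbhd_map i phi b)).
  rewrite -{1}(dsum_atK b) in_mapE in_pr; apply: eq_bigr => j _.
  by rewrite bd_mapE.
suff r : reflection_pair i N M by exists r.
apply: (@ReflectionPair _ _ _ _ N M phi psi) => //.
- move=> p; have [x <-] := onto p; exists (nbhd_map i psi (dsum_mk x)).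
  by rewrite inE PsiK; apply: eq_bigr => j _; rewrite dsum_mkK.
- move=> b; rewrite inE ker; split=> -[y yb]; exists y.
    by apply: dsum_eq => j; rewrite out_mapE yb.
  by move=> j; rewrite -yb out_mapE.
move=> b; apply: dsum_eq => j; rewrite out_mapE.
have := out_pr (fun k => dsum_at k (nbhd_map i phi b)) j.
rewrite -inE -in_mapE dsum_atK => <-.
by rewrite nbhd_mapE /bd_map out_mapE.
Qed.

End Sigma.

Section Main.

Variables (R : realType) (n : nat) (C : symCartan n) (D : preprojData C) (i : 'I_n).

Local Notation s := (dual_act (refl R C i)).

Lemma dim_vertex_lt (M N : rep D) (c : R) : 0 < c ->
  dimvec R (fun j => {:N j}%VS) - dimvec R (fun j => {:M j}%VS) = c *: sroot R i ->
  (\dim {:M i} < \dim {:N i})%N.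
Proof.
move=> c0 /rowP/(_ i); rewrite !mxE !dimvecE !eqxx mulr1 => E.
by rewrite -(ltr_nat R) -subr_gt0 E.
Qed.

(** Both signs at once: for [+] the module [M] is the source of the pair, for [-] it
    is the target. Since [0 < c], the dimension at [i] increases from [M] to [N],
    and the bound of the matching sign applies to [Stab N]. *)
Lemma Sigma_brick_Stab (e : bool) (M N : fdmod D) (c : R) : 0 < c ->
  is_Sigma e i M N ->
  refl R C i (dimvec R (fun j => {:M j}%VS)) - dimvec R (fun j => {:M j}%VS)
    = c *: sroot R i ->
  brick M ->
  [/\ dimvec R (fun j => {:N j}%VS) = refl R C i (dimvec R (fun j => {:M j}%VS)),
      brick N & Stab R N = sigma_sgn C e i (Stab R M)].
Proof.
move=> c0; case: e => /=.
  case/Sigma_pos_pair => r _; rewrite (refl_dimvec_full r) => E Mb.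
  split=> //; first exact: brick_fwd r Mb.
  have lt := dim_vertex_lt c0 E; apply/seteqP; split=> t.
    move=> tN; have ti := quotient_bound r lt tN.
    exists (s t); last exact: dual_act_reflK.
    by split; [apply: (semistable_bwd r) | rewrite /= dual_act_refl_sroot oppr_ge0].
  by case=> u [uM ui] <-; apply: (semistable_fwd r).
case/Sigma_neg_pair => r _ E Mb.
have NE : dimvec R (fun j => {:N j}%VS) = refl R C i (dimvec R (fun j => {:M j}%VS)).
  by rewrite -(refl_dimvec_full r) reflK.
split=> //; first exact: brick_bwd r Mb.
have lt := dim_vertex_lt c0 (etrans (congr1 (fun x => x - _) NE) E).
apply/seteqP; split=> t.
  move=> tN; have ti := submodule_bound r lt tN.
  exists (s t); last exact: dual_act_reflK.
  by split; [apply: (semistable_fwd r) | rewrite /= dual_act_refl_sroot oppr_le0].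
by case=> u [uM ui] <-; apply: (semistable_bwd r).
Qed.

End Main.

Theorem theorem5p3 (R : realType) (n : nat) (C : symCartan n) (D : preprojData C)
    (j : 'I_n) (r : nat) (idx : nat -> 'I_n) (e : nat -> bool)
    (beta : rspace R n) (X : fdmod D)
    (beta_root : positive_root C beta)
    (beta_expr : positive_expression C beta r idx j)
    (X_def : Sigma_word idx e j r X) :
  brick X /\ Stab R X = sigma_word C idx e j r.
Proof.
have step k : (1 <= k <= r)%N -> exists2 c : R, 0 < c &
  root_word R C idx j k - root_word R C idx j k.-1 = c *: sroot R (idx k).
  by case: beta_expr => _; apply.
(* The dimension vector is carried along, as each step compares dimensions at one
   vertex. *)
suff [] : [/\ dimvec R (fun k => {:X k}%VS) = root_word R C idx j r,
              brick X & Stab R X = sigma_word C idx e j r] by [].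
clear beta beta_root beta_expr.
elim: r X X_def step => [X -> _|q IH X [Y Yq YX] step].
  split; [|exact: brick_simple|exact: stab_simple].
  apply/rowP => k; rewrite dimvecE srootE.
  by rewrite dim_simple.
have [k|dY bY sY] := IH Y Yq; first by case/andP=> k1 kq; apply: step; rewrite k1 leqW.
have [|c c0 cE] := step q.+1; first by rewrite leqnn.
have [|dX bX sX] := Sigma_brick_Stab c0 YX _ bY; first by rewrite dY.
by split=> //; rewrite ?dX ?dY // sX sY.
Qed.
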